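(* The system $\mathsf{RCA}_0^\omega+\mathsf{QF\text{-}AC}^{2,0}$ proves \[\big[(\kappa_0^3)\wedge\mathsf{WKL}\big]\leftrightarrow\big[(\exists^3)\vee\mathsf{MUC}\big]\leftrightarrow\big[(\kappa_0^3)\wedge\mathsf{FF}\big];\] the system $\mathsf{RCA}_0^\omega$ proves $\mathsf{FF}\leftrightarrow[(\exists^2)\vee\mathsf{MUC}]$; and the system $\mathsf{WKL}_0^\omega+\mathsf{QF\text{-}AC}^{2,0}$ proves $\mathsf{FF}\leftrightarrow[(\exists^2)\vee(\kappa_0^3)]$.
   Context: Work in the language $\mathsf{L}_\omega$ of higher-order arithmetic with variables of all finite types: $0$ is the type of natural numbers and $\sigma\to\tau$ the type of mappings; $1=0\to0$, $2=1\to0$, $3=2\to0$. Equality at higher types is pointwise; $\le_\tau$ is defined pointwise using $\le_0$. $\mathsf{RCA}_0^\omega$ is Kohlenbach's base theory: basic axioms making $0,1,<,+,\times$ an ordered semiring, the combinators $K,S$, the recursor $\mathbf{R}_0$ ($\mathbf{R}_0(f,m,0)=m$, $\mathbf{R}_0(f,m,n+1)=f(\mathbf{R}_0(f,m,n))$), extensionality at all types, quantifier-free induction, and $\mathsf{QF\text{-}AC}^{1,0}$. $\mathsf{QF\text{-}AC}^{\sigma,\tau}$ is the schema $(\forall x^\sigma)(\exists y^\tau)A(x,y)\to(\exists Y^{\sigma\to\tau})(\forall x^\sigma)A(x,Y(x))$ for quantifier-free $A$. $\mathsf{WKL}$: every infinite binary tree has a path; $\mathsf{WKL}_0^\omega=\mathsf{RCA}_0^\omega+\mathsf{WKL}$.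 $\overline{f}n=\langle f(0),\dots,f(n-1)\rangle$; $C$ is the set of $f^1\le_1 1$. A chain $A_1\leftrightarrow A_2\leftrightarrow\cdots$ means each consecutive equivalence. $(\exists^2)$: $(\exists\varphi^2\le_2 1)(\forall f^1)\big[(\exists n^0)(f(n)=0)\leftrightarrow\varphi(f)=0\big]$. $(\exists^3)$: $(\exists E^3\le_3 1)(\forall Y^2)\big[(\exists f^1)(Y(f)=0)\leftrightarrow E(Y)=0\big]$. $(\kappa_0^3)$: $(\exists \kappa_0^3)(\forall Y^2)\big[\kappa_0(Y)=0\leftrightarrow(\exists f\in C)(Y(f)>0)\big]$. $\mathsf{MUC}$: $(\exists\Omega^3)(\forall Y^2)(\forall f,g\in C)(\overline f\Omega(Y)=\overline g\Omega(Y)\to Y(f)=Y(g))$. $\mathsf{FF}$: $(\exists\Phi^3)(\forall Y^2\in\mathsf{cont})(\forall f,g\in C)(\overline f\Phi(Y)=\overline g\Phi(Y)\to Y(f)=Y(g))$, where $Y\in\mathsf{cont}$ means $(\forall f^1)(\exists N^0)(\forall g^1)(\overline fN=\overline gN\to Y(f)=Y(g))$. *)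

(* Defs.v *)
From Stdlib Require Import List.
Import ListNotations.
Set Implicit Arguments.
Unset Strict Implicit.

Inductive ty : Type :=
| T0 : ty
| Arr : ty -> ty -> ty.

Declare Scope ty_scope.
Delimit Scope ty_scope with ty.
Bind Scope ty_scope with ty.
Notation "s ⟶ t" := (Arr s t) (at level 55, right associativity) : ty_scope.
Local Open Scope ty_scope.

Definition T1 : ty := T0 ⟶ T0.
Definition T2 : ty := T1 ⟶ T0.
Definition T3 : ty := T2 ⟶ T0.

(** Syntax is well typed and well scoped by construction: variables are typed
    de Bruijn indices into a context, [VZ] being the innermost binder. *)
Definition ctx : Type := list ty.

Inductive var : ctx -> ty -> Type :=
| VZ : forall G s, var (s :: G) s
| VS : forall G s t, var G t -> var (s :: G) t.
Arguments VZ {G s}.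
Arguments VS {G s t} _.

Inductive term (G : ctx) : ty -> Type :=
| Var : forall t, var G t -> term G t
| App : forall s t, term G (s ⟶ t) -> term G s -> term G t
| Zero : term G T0
| One : term G T0
| Plus : term G (T0 ⟶ T0 ⟶ T0)
| Times : term G (T0 ⟶ T0 ⟶ T0)
| K : forall s t, term G (s ⟶ t ⟶ s)
| S : forall r s t, term G ((r ⟶ s ⟶ t) ⟶ (r ⟶ s) ⟶ r ⟶ t)
| R0 : term G ((T0 ⟶ T0) ⟶ T0 ⟶ T0 ⟶ T0).
Arguments Zero {G}.
Arguments One {G}.
Arguments Plus {G}.
Arguments Times {G}.
Arguments K {G s t}.
Arguments S {G r s t}.
Arguments R0 {G}.

(** The only prime formulas are [s = t] and [s < t] at type 0. *)
Inductive formula : ctx -> Type :=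
| Eq0 : forall G, term G T0 -> term G T0 -> formula G
| Lt0 : forall G, term G T0 -> term G T0 -> formula G
| Bot : forall G, formula G
| And : forall G, formula G -> formula G -> formula G
| Or : forall G, formula G -> formula G -> formula G
| Imp : forall G, formula G -> formula G -> formula G
| All : forall G s, formula (s :: G) -> formula G
| Ex : forall G s, formula (s :: G) -> formula G.
Arguments Bot {G}.
Arguments All {G} s _.
Arguments Ex {G} s _.

Fixpoint qf {G} (A : formula G) : Prop :=
  match A with
  | Eq0 _ _ | Lt0 _ _ | Bot => True
  | And A B | Or A B | Imp A B => qf A /\ qf B
  | All _ _ | Ex _ _ => False
  end.

Definition ren (G D : ctx) : Type := forall t, var G t -> var D t.
Definition sub (G D : ctx) : Type := forall t, var G t -> term D t.

Fixpoint tsubst {G D} (th : sub G D) {t} (x : term G t) : term D t :=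
  match x with
  | Var v => th _ v
  | App f a => App (tsubst th f) (tsubst th a)
  | Zero => Zero
  | One => One
  | Plus => Plus
  | Times => Times
  | K => K
  | S => S
  | R0 => R0
  end.

Definition tlift {G} s {t} (x : term G t) : term (s :: G) t :=
  tsubst (fun _ v => Var (VS v)) x.

Definition scons {G D s} (a : term D s) (th : sub G D) : sub (s :: G) D :=
  fun t v =>
    match v in var G' t' return
      match G' with
      | [] => unit
      | s' :: G0 => term D s' -> sub G0 D -> term D t'
      end
    with
    | VZ => fun a _ => a
    | VS w => fun _ th => th _ w
    end a th.

Definition up {G D} (th : sub G D) s : sub (s :: G) (s :: D) :=
  scons (Var VZ) (fun _ v => tlift s (th _ v)).
Arguments up {G D} th s _ _.

Fixpoint fsubst {G} (A : formula G) : forall D, sub G D -> formula D :=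
  match A with
  | Eq0 x y => fun _ th => Eq0 (tsubst th x) (tsubst th y)
  | Lt0 x y => fun _ th => Lt0 (tsubst th x) (tsubst th y)
  | Bot => fun _ _ => Bot
  | And A B => fun _ th => And (fsubst A th) (fsubst B th)
  | Or A B => fun _ th => Or (fsubst A th) (fsubst B th)
  | Imp A B => fun _ th => Imp (fsubst A th) (fsubst B th)
  | All s A => fun _ th => All s (fsubst A (up th s))
  | Ex s A => fun _ th => Ex s (fsubst A (up th s))
  end.

Definition flift {G} s (A : formula G) : formula (s :: G) :=
  fsubst A (fun _ v => Var (VS v)).

Definition inst {G s} (A : formula (s :: G)) (a : term G s) : formula G :=
  fsubst A (scons a (fun _ v => Var v)).

Declare Scope ho_scope.
Delimit Scope ho_scope with ho.
Bind Scope ho_scope with term.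
Bind Scope ho_scope with formula.
Notation "f · a" := (App f a) (at level 38, left associativity) : ho_scope.
Notation "x + y" := (App (App Plus x) y) : ho_scope.
Notation "x * y" := (App (App Times x) y) : ho_scope.
Notation "x ↑" := (tlift _ x) (at level 1, left associativity, format "x ↑") : ho_scope.
Notation "x ≐ y" := (Eq0 x y) (at level 70) : ho_scope.
Notation "x ≺ y" := (Lt0 x y) (at level 70) : ho_scope.
Notation "A ⩓ B" := (And A B) (at level 80, right associativity) : ho_scope.
Notation "A ⩔ B" := (Or A B) (at level 85, right associativity) : ho_scope.
Notation "A ⇒ B" := (Imp A B) (at level 90, right associativity) : ho_scope.
Notation "A ⇔ B" := (And (Imp A B) (Imp B A)) (at level 95) : ho_scope.
Notation "∀[ s ] A" := (All s A) (at level 99, A at level 200) : ho_scope.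
Notation "∃[ s ] A" := (Ex s A) (at level 99, A at level 200) : ho_scope.
Notation "¬ A" := (Imp A Bot) (at level 75, right associativity) : ho_scope.
Notation v0 := (Var VZ).
Notation v1 := (Var (VS VZ)).
Notation v2 := (Var (VS (VS VZ))).
Notation v3 := (Var (VS (VS (VS VZ)))).
Local Open Scope ho_scope.

Definition Le0 {G} (x y : term G T0) : formula G := x ≺ y ⩔ x ≐ y.

Fixpoint EqT {t} : forall G, term G t -> term G t -> formula G :=
  match t with
  | T0 => fun _ x y => x ≐ y
  | s ⟶ t => fun _ x y => ∀[s] EqT (x↑ · v0) (y↑ · v0)
  end.

Fixpoint LeT {t} : forall G, term G t -> term G t -> formula G :=
  match t with
  | T0 => fun _ x y => Le0 x y
  | s ⟶ t => fun _ x y => ∀[s] LeT (x↑ · v0) (y↑ · v0)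
  end.

(** The constant object 1 of each type, as in [phi <=_2 1]. *)
Fixpoint OneT {G} (t : ty) : term G t :=
  match t with
  | T0 => One
  | s ⟶ t => K · OneT t
  end.

(** A theory assigns axioms to every context; the free variables of an axiom
    are parameters, to be read as universally quantified. *)
Definition theory : Type := forall G, formula G -> Prop.

(** Classical natural deduction for many-sorted predicate logic with equality
    of type 0. *)
Inductive deriv (T : theory) : forall G, list (formula G) -> formula G -> Prop :=
| d_hyp G (H : list (formula G)) A : In A H -> deriv T H A
| d_ax G (H : list (formula G)) A : T G A -> deriv T H A
| d_impI G (H : list (formula G)) A B : deriv T (A :: H) B -> deriv T H (A ⇒ B)
| d_impE G (H : list (formula G)) A B :
    deriv T H (A ⇒ B) -> deriv T H A -> deriv T H B
| d_andI G (H : list (formula G)) A B :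
    deriv T H A -> deriv T H B -> deriv T H (A ⩓ B)
| d_andE1 G (H : list (formula G)) A B : deriv T H (A ⩓ B) -> deriv T H A
| d_andE2 G (H : list (formula G)) A B : deriv T H (A ⩓ B) -> deriv T H B
| d_orI1 G (H : list (formula G)) A B : deriv T H A -> deriv T H (A ⩔ B)
| d_orI2 G (H : list (formula G)) A B : deriv T H B -> deriv T H (A ⩔ B)
| d_orE G (H : list (formula G)) A B C :
    deriv T H (A ⩔ B) -> deriv T (A :: H) C -> deriv T (B :: H) C -> deriv T H C
| d_raa G (H : list (formula G)) A : deriv T ((¬ A) :: H) Bot -> deriv T H A
| d_allI G (H : list (formula G)) s (A : formula (s :: G)) :
    deriv T (map (flift s) H) A -> deriv T H (∀[s] A)
| d_allE G (H : list (formula G)) s (A : formula (s :: G)) (a : term G s) :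
    deriv T H (∀[s] A) -> deriv T H (inst A a)
| d_exI G (H : list (formula G)) s (A : formula (s :: G)) (a : term G s) :
    deriv T H (inst A a) -> deriv T H (∃[s] A)
| d_exE G (H : list (formula G)) s (A : formula (s :: G)) (B : formula G) :
    deriv T H (∃[s] A) -> deriv T (A :: map (flift s) H) (flift s B) -> deriv T H B
| d_eqI G (H : list (formula G)) (x : term G T0) : deriv T H (x ≐ x)
| d_eqE G (H : list (formula G)) (x y : term G T0) (A : formula (T0 :: G)) :
    deriv T H (x ≐ y) -> deriv T H (inst A x) -> deriv T H (inst A y).

Definition proves (T : theory) (A : formula []) : Prop := deriv T [] A.

Definition tunion (T U : theory) : theory := fun G A => T G A \/ U G A.
Notation "T ⊕ U" := (tunion T U) (at level 50, left associativity).
Notation "T ⊢ A" := (proves T A%ho) (at level 100, A at level 200).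

(** Discretely ordered commutative semirings with least element 0, in which
    differences exist. *)
Inductive OrderedSemiring : theory :=
| plus_assoc G (x y z : term G T0) : OrderedSemiring ((x + y) + z ≐ x + (y + z))
| plus_comm G (x y : term G T0) : OrderedSemiring (x + y ≐ y + x)
| plus_zero G (x : term G T0) : OrderedSemiring (x + Zero ≐ x)
| times_assoc G (x y z : term G T0) : OrderedSemiring ((x * y) * z ≐ x * (y * z))
| times_comm G (x y : term G T0) : OrderedSemiring (x * y ≐ y * x)
| times_zero G (x : term G T0) : OrderedSemiring (x * Zero ≐ Zero)
| times_one G (x : term G T0) : OrderedSemiring (x * One ≐ x)
| distr G (x y z : term G T0) : OrderedSemiring (x * (y + z) ≐ x * y + x * z)
| lt_irrefl G (x : term G T0) : OrderedSemiring (¬ (x ≺ x))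
| lt_trans G (x y z : term G T0) : OrderedSemiring (x ≺ y ⇒ y ≺ z ⇒ x ≺ z)
| lt_total G (x y : term G T0) : OrderedSemiring (x ≺ y ⩔ x ≐ y ⩔ y ≺ x)
| lt_plus G (x y z : term G T0) : OrderedSemiring (x ≺ y ⇒ x + z ≺ y + z)
| lt_times G (x y z : term G T0) : OrderedSemiring (Zero ≺ z ⇒ x ≺ y ⇒ x * z ≺ y * z)
| lt_diff G (x y : term G T0) : OrderedSemiring (x ≺ y ⇒ ∃[T0] x↑ + v0 ≐ y↑)
| lt_zero_one G : OrderedSemiring (G := G) (Zero ≺ One)
| lt_discrete G (x : term G T0) : OrderedSemiring (Zero ≺ x ⇒ Le0 One x)
| le_zero G (x : term G T0) : OrderedSemiring (Le0 Zero x).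

(** From the context of [A(x,y)] (with [y] innermost) to that of [Y], [x]:
    [y] is replaced by [Y(x)]. *)
Definition skolem_sub {G s t} : sub (t :: s :: G) (s :: (s ⟶ t) :: G) :=
  scons (v1 · v0) (scons v0 (fun _ v => Var (VS (VS v)))).

Inductive QF_AC (s t : ty) : theory :=
| qf_ac G (A : formula (t :: s :: G)) : qf A ->
    QF_AC s t ((∀[s] ∃[t] A) ⇒ ∃[s ⟶ t] ∀[s] fsubst A skolem_sub).

(** [A(n)] to [A(n+1)]. *)
Definition succ_sub {G} : sub (T0 :: G) (T0 :: G) :=
  scons (v0 + One) (fun _ v => Var (VS v)).

Inductive RCA_basic : theory :=
| ax_semiring G (A : formula G) : OrderedSemiring A -> RCA_basic A
| ax_K G s t (x : term G s) (y : term G t) : RCA_basic (EqT (K · x · y) x)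
| ax_S G r s t (x : term G (r ⟶ s ⟶ t)) (y : term G (r ⟶ s)) (z : term G r) :
    RCA_basic (EqT (S · x · y · z) (x · z · (y · z)))
| ax_R0_zero G (f : term G T1) (m : term G T0) : RCA_basic (R0 · f · m · Zero ≐ m)
| ax_R0_succ G (f : term G T1) (m n : term G T0) :
    RCA_basic (R0 · f · m · (n + One) ≐ f · (R0 · f · m · n))
| ax_ext G s t (x y : term G s) (f : term G (s ⟶ t)) :
    RCA_basic (EqT x y ⇒ EqT (f · x) (f · y))
| ax_qf_ind G (A : formula (T0 :: G)) : qf A ->
    RCA_basic (inst A Zero ⇒ (∀[T0] A ⇒ fsubst A succ_sub) ⇒ ∀[T0] A).

Definition RCA0w : theory := RCA_basic ⊕ QF_AC T1 T0.

(** Finite sequences are coded by numbers: the empty sequence by 0, and the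
    extension of [s] by the entry [a] by [<s,a> + 1], where
    [<x,y> = (x+y)^2 + y] is an injective pairing. *)
Definition snoc {G} (s a : term G T0) : term G T0 :=
  ((s + a) * (s + a) + a) + One.

(** [h(n)] is the code of [f(0),...,f(n-1)], for every [n]. Such an [h] exists
    and is unique, provably in [RCA0w]. *)
Definition IsBar {G} (f h : term G T1) : formula G :=
  h · Zero ≐ Zero ⩓
  ∀[T0] h↑ · (v0 + One) ≐ snoc (h↑ · v0) (f↑ · v0).

(** Equality of the codes of the initial segments of length [n] of [f], [g]. *)
Definition BarEq {G} (f g : term G T1) (n : term G T0) : formula G :=
  ∃[T1] ∃[T1] IsBar f↑↑ v1 ⩓ IsBar g↑↑ v0 ⩓ v1 · n↑↑ ≐ v0 · n↑↑.

Definition InC {G} (f : term G T1) : formula G := LeT f (OneT T1).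

(** A set of numbers is given by its characteristic function. *)
Definition Mem {G} (n : term G T0) (X : term G T1) : formula G := X · n ≐ One.

(** [T] is a set of codes of finite binary sequences closed under initial
    segments. *)
Definition BinaryTree {G} (T : term G T1) : formula G :=
  LeT T (OneT T1) ⩓
  ∀[T0] Mem v0 T↑ ⇒
    v0 ≐ Zero ⩔
    ∃[T0] ∃[T0] Le0 v0 One ⩓ v2 ≐ snoc v1 v0 ⩓ Mem v1 T↑↑↑.

Definition Infinite {G} (X : term G T1) : formula G :=
  ∀[T0] ∃[T0] v1 ≺ v0 ⩓ Mem v0 X↑↑.

Definition Path {G} (f T : term G T1) : formula G :=
  InC f ⩓ ∃[T1] IsBar f↑ v0 ⩓ ∀[T0] Mem (v1 · v0) T↑↑.

Definition WKL {G} : formula G :=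
  ∀[T1] BinaryTree v0 ⩓ Infinite v0 ⇒ ∃[T1] Path v0 v1.

Definition Exists2 {G} : formula G :=
  ∃[T2] LeT v0 (OneT T2) ⩓
    ∀[T1] (∃[T0] v1 · v0 ≐ Zero) ⇔ (v1 · v0 ≐ Zero).

Definition Exists3 {G} : formula G :=
  ∃[T3] LeT v0 (OneT T3) ⩓
    ∀[T2] (∃[T1] v1 · v0 ≐ Zero) ⇔ (v1 · v0 ≐ Zero).

Definition Kappa0 {G} : formula G :=
  ∃[T3] ∀[T2] (v1 · v0 ≐ Zero) ⇔ (∃[T1] InC v0 ⩓ Zero ≺ v1 · v0).

Definition Cont {G} (Y : term G T2) : formula G :=
  ∀[T1] ∃[T0] ∀[T1] BarEq v2 v0 v1 ⇒ Y↑↑↑ · v2 ≐ Y↑↑↑ · v0.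

(** [m] is a modulus of uniform continuity of [Y] on [C]. *)
Definition ModulusOnC {G} (Y : term G T2) (m : term G T0) : formula G :=
  ∀[T1] ∀[T1] InC v1 ⩓ InC v0 ⇒
    BarEq v1 v0 m↑↑ ⇒ Y↑↑ · v1 ≐ Y↑↑ · v0.

Definition MUC {G} : formula G :=
  ∃[T3] ∀[T2] ModulusOnC v0 (v1 · v0).

Definition FF {G} : formula G :=
  ∃[T3] ∀[T2] Cont v0 ⇒ ModulusOnC v0 (v1 · v0).

Inductive WKL_ax : theory :=
| wkl_ax G : WKL_ax (G := G) WKL.

Definition WKL0w : theory := RCA0w ⊕ WKL_ax.

(* Main.v *)
(** By Goedel's completeness theorem for the natural deduction calculus, whose
    Henkin models can be made extensional because of the axiom of
    extensionality, it suffices to argue in an arbitrary extensional model of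
    the base theory; its numbers may be nonstandard.

    There the three equivalences follow from these implications.
    - [∃³] yields [∃²] and [κ]; conversely [∃²] and [κ] yield [∃³], because
      [∃²] decodes every element of Baire space from its graph.
    - [FF] yields [∃²] or [MUC]: by Grilliot's trick, without [∃²] all
      functionals of type 2 are continuous.
    - [∃²] yields [FF]: a continuous [Y] has a modulus on Cantor space (else a
      path through neighbourhoods without modulus contradicts continuity), and
      being a modulus is arithmetical, since by continuity it concerns only
      finite sequences continued with zeros.
    - [MUC] yields [κ]: finitely many sequences have to be searched.
    - [FF] yields [WKL]: a tree without a path defines a continuous functional
      that is unbounded on Cantor space.
    - [κ], [WKL] and choice yield [∃²] or [MUC]: if all functionals are
      continuous, [WKL] for the tree of neighbourhoods on which [Y] is not
      constant gives a modulus, and [κ] decides whether a number is one. *)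

Require Import Defs.
From Stdlib Require Import List Arith Lia Cantor Eqdep Program.Equality.
From Stdlib Require Import FunctionalExtensionality PropExtensionality ClassicalEpsilon.
Import ListNotations.
Set Implicit Arguments.
Unset Strict Implicit.
Local Open Scope ty_scope.
Local Open Scope ho_scope.
Local Notation Suc := Datatypes.S.

(** * Substitution *)

(** The theorem asserts derivability in formal systems, whose derivations would be unwieldy to write
    out; this is the reason for the detour through models. Terms are scoped by contexts, so Henkin
    constants are not added to a fixed language: each stage of the construction enlarges the context
    by one variable, which plays the constant, and an element of the model is a term followed
    through all later stages. Equality at higher types is a defined notion, so elements have to be
    identified modulo provable pointwise equality.

    Inside a model the ambient logic is classical, but an arrow type contains only some functions,
    and induction and choice hold only for properties of the form [f @ n = 0] with [f] an element of
    the model. The notions [definable] and [decidable], with the tactics that establish them, carry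
    this bookkeeping. The strength of ∃² and κ shows in that they close the decidable properties
    under quantifiers over numbers and over Cantor space, respectively. *)

Lemma var_cons_ind (G : ctx) s (P : forall t, var (s :: G) t -> Prop) :
  P s VZ -> (forall t v, P t (VS v)) -> forall t v, P t v.
Proof. intros HZ HS t v. dependent destruction v; auto. Qed.

Lemma sub_ext (G D : ctx) (th th' : sub G D) :
  (forall t v, th t v = th' t v) -> th = th'.
Proof.
  intros H. apply functional_extensionality_dep; intro t.
  apply functional_extensionality; auto.
Qed.

Lemma sub_cons_ext (G D : ctx) s (th th' : sub (s :: G) D) :
  th s VZ = th' s VZ -> (forall t v, th t (VS v) = th' t (VS v)) -> th = th'.
Proof.
  intros HZ HS. apply sub_ext.
  apply (@var_cons_ind G s (fun t v => th t v = th' t v)); auto.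
Qed.

Lemma tsubst_comp (G D E : ctx) (th : sub G D) (th' : sub D E) t (x : term G t) :
  tsubst th' (tsubst th x) = tsubst (fun u v => tsubst th' (th u v)) x.
Proof. induction x; cbn; congruence. Qed.

Lemma tsubst_var (G : ctx) t (x : term G t) : tsubst (fun _ v => Var v) x = x.
Proof. induction x; cbn; congruence. Qed.

Lemma tsubst_up_tlift (G D : ctx) (th : sub G D) s t (x : term G t) :
  tsubst (up th s) (tlift s x) = tlift s (tsubst th x).
Proof. unfold tlift. rewrite !tsubst_comp. reflexivity. Qed.

Lemma up_comp (G D E : ctx) (th : sub G D) (th' : sub D E) s :
  (fun u v => tsubst (up th' s) (up th s u v)) = up (fun u v => tsubst th' (th u v)) s.
Proof.
  apply sub_cons_ext; [reflexivity | intros t v].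
  exact (tsubst_up_tlift th' s (th t v)).
Qed.

Lemma up_var (G : ctx) s : up (fun t (v : var G t) => Var v) s = fun t v => Var v.
Proof. apply sub_cons_ext; reflexivity. Qed.

Lemma fsubst_comp (G : ctx) (A : formula G) : forall D E (th : sub G D) (th' : sub D E),
  fsubst (fsubst A th) th' = fsubst A (fun u v => tsubst th' (th u v)).
Proof.
  induction A; intros; cbn; rewrite ?tsubst_comp, ?IHA1, ?IHA2; try reflexivity;
    rewrite IHA, up_comp; reflexivity.
Qed.

Lemma fsubst_var (G : ctx) (A : formula G) : fsubst A (fun _ v => Var v) = A.
Proof.
  induction A; cbn; rewrite ?tsubst_var, ?up_var; congruence.
Qed.

Lemma fsubst_flift (G D : ctx) (A : formula G) s (th : sub (s :: G) D) :
  fsubst (flift s A) th = fsubst A (fun t v => th t (VS v)).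
Proof. unfold flift. rewrite fsubst_comp. reflexivity. Qed.

Lemma flift_fsubst (G D : ctx) (A : formula G) s (th : sub G D) :
  flift s (fsubst A th) = fsubst A (fun t v => tlift s (th t v)).
Proof. unfold flift. rewrite fsubst_comp. reflexivity. Qed.

Lemma fsubst_up_flift (G D : ctx) (A : formula G) s (th : sub G D) :
  fsubst (flift s A) (up th s) = flift s (fsubst A th).
Proof. rewrite fsubst_flift, flift_fsubst. reflexivity. Qed.

Lemma tsubst_scons_tlift (G D : ctx) s (a : term D s) (th : sub G D) t (x : term G t) :
  tsubst (scons a th) (tlift s x) = tsubst th x.
Proof. unfold tlift. rewrite tsubst_comp. reflexivity. Qed.

Lemma fsubst_inst (G D : ctx) s (A : formula (s :: G)) (a : term G s) (th : sub G D) :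
  fsubst (inst A a) th = inst (fsubst A (up th s)) (tsubst th a).
Proof.
  unfold inst. rewrite !fsubst_comp. f_equal.
  apply sub_cons_ext; [reflexivity | intros t v].
  cbn. rewrite tsubst_scons_tlift, tsubst_var. reflexivity.
Qed.

Lemma inst_up (G D : ctx) s (A : formula (s :: G)) (a : term D s) (th : sub G D) :
  inst (fsubst A (up th s)) a = fsubst A (scons a th).
Proof.
  unfold inst. rewrite fsubst_comp. f_equal.
  apply sub_cons_ext; [reflexivity | intros t v].
  cbn. rewrite tsubst_scons_tlift, tsubst_var. reflexivity.
Qed.

Lemma fsubst_EqT t : forall (G D : ctx) (th : sub G D) (x y : term G t),
  fsubst (EqT x y) th = EqT (tsubst th x) (tsubst th y).
Proof.
  induction t; intros; cbn; [reflexivity |].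
  rewrite IHt2. cbn. rewrite !tsubst_up_tlift. reflexivity.
Qed.

(** * Weakening and substitution in derivations *)

Definition subst_closed (T : theory) : Prop :=
  forall G A D (th : sub G D), T G A -> T D (fsubst A th).

Lemma deriv_weaken (T : theory) (G : ctx) (H : list (formula G)) A :
  deriv T H A -> forall H', incl H H' -> deriv T H' A.
Proof.
  induction 1; intros H' HH.
  - apply d_hyp; auto.
  - apply d_ax; auto.
  - apply d_impI, IHderiv. intros B' [<- | HB]; [left | right]; auto.
  - eapply d_impE; eauto.
  - apply d_andI; auto.
  - eapply d_andE1; eauto.
  - eapply d_andE2; eauto.
  - apply d_orI1; auto.
  - apply d_orI2; auto.
  - eapply d_orE; [apply IHderiv1 | apply IHderiv2 | apply IHderiv3]; auto;
      intros B' [<- | HB]; [left | right | left | right]; auto.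
  - apply d_raa, IHderiv. intros B' [<- | HB]; [left | right]; auto.
  - apply d_allI, IHderiv, incl_map, HH.
  - apply d_allE; auto.
  - eapply d_exI; eauto.
  - eapply d_exE; [apply IHderiv1; auto | apply IHderiv2].
    intros B' [<- | HB]; [left | right]; auto. apply (incl_map (flift s) HH), HB.
  - apply d_eqI.
  - eapply d_eqE; eauto.
Qed.

Lemma map_fsubst_up (G D : ctx) (H : list (formula G)) s (th : sub G D) :
  map (fun B => fsubst B (up th s)) (map (flift s) H)
  = map (flift s) (map (fun B => fsubst B th) H).
Proof.
  rewrite !map_map. apply map_ext. intros A. apply fsubst_up_flift.
Qed.

(** Axioms carry their parameters as free variables, so a derivation can be moved to another context
    only if the axioms are closed under substitution. *)
Lemma deriv_subst (T : theory) (HT : subst_closed T) (G : ctx) (H : list (formula G)) A :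
  deriv T H A -> forall D (th : sub G D),
  deriv T (map (fun B => fsubst B th) H) (fsubst A th).
Proof.
  induction 1; intros D th; cbn in *.
  - apply d_hyp, (in_map (fun B => fsubst B th)); assumption.
  - apply d_ax, HT; assumption.
  - apply d_impI, IHderiv.
  - eapply d_impE; [apply IHderiv1 | apply IHderiv2].
  - apply d_andI; auto.
  - eapply d_andE1; apply IHderiv.
  - eapply d_andE2; apply IHderiv.
  - apply d_orI1, IHderiv.
  - apply d_orI2, IHderiv.
  - eapply d_orE; [apply IHderiv1 | apply IHderiv2 | apply IHderiv3].
  - apply d_raa, IHderiv.
  - apply d_allI. rewrite <- map_fsubst_up. apply IHderiv.
  - rewrite fsubst_inst. apply d_allE, IHderiv.
  - apply d_exI with (a := tsubst th a). rewrite <- fsubst_inst. apply IHderiv.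
  - eapply d_exE; [apply IHderiv1 |].
    rewrite <- map_fsubst_up, <- fsubst_up_flift. apply IHderiv2.
  - apply d_eqI.
  - rewrite fsubst_inst. eapply d_eqE; [apply IHderiv1 |].
    rewrite <- fsubst_inst. apply IHderiv2.
Qed.

Lemma deriv_flift (T : theory) (HT : subst_closed T) (G : ctx) (H : list (formula G)) A s :
  deriv T H A -> deriv T (map (flift s) H) (flift s A).
Proof. intros HA. exact (deriv_subst HT HA (fun _ v => Var (VS v))). Qed.

(** * Goedel numbering *)

Definition pack (a b : nat) : nat := to_nat (a, b).
Arguments pack : simpl never.
Lemma pack_inj a b c d : pack a b = pack c d -> a = c /\ b = d.
Proof. intros H. assert (E : (a, b) = (c, d)) by exact (to_nat_inj _ _ H). split; congruence. Qed.

Fixpoint code_ty (t : ty) : nat :=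
  match t with T0 => 0 | s ⟶ t => Suc (pack (code_ty s) (code_ty t)) end.

Fixpoint code_var {G t} (v : var G t) : nat :=
  match v with VZ => 0 | VS w => Suc (code_var w) end.

Fixpoint code_term {G t} (x : term G t) : nat :=
  match x with
  | Var v => pack 0 (code_var v)
  | @App _ s t f a => pack 1 (pack (pack (code_ty s) (code_ty t)) (pack (code_term f) (code_term a)))
  | Zero => pack 2 0
  | One => pack 3 0
  | Plus => pack 4 0
  | Times => pack 5 0
  | @K _ s t => pack 6 (pack (code_ty s) (code_ty t))
  | @S _ r s t => pack 7 (pack (code_ty r) (pack (code_ty s) (code_ty t)))
  | R0 => pack 8 0
  end.

Fixpoint code_formula {G} (A : formula G) : nat :=
  match A with
  | Eq0 x y => pack 0 (pack (code_term x) (code_term y))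
  | Lt0 x y => pack 1 (pack (code_term x) (code_term y))
  | Bot => pack 2 0
  | And A B => pack 3 (pack (code_formula A) (code_formula B))
  | Or A B => pack 4 (pack (code_formula A) (code_formula B))
  | Imp A B => pack 5 (pack (code_formula A) (code_formula B))
  | All s A => pack 6 (pack (code_ty s) (code_formula A))
  | Ex s A => pack 7 (pack (code_ty s) (code_formula A))
  end.

Ltac unpack :=
  repeat match goal with
  | H : pack _ _ = pack _ _ |- _ => apply pack_inj in H; destruct H
  | H : Suc _ = Suc _ |- _ => apply Nat.succ_inj in H
  end; try discriminate.

Lemma code_ty_inj s : forall t, code_ty s = code_ty t -> s = t.
Proof.
  induction s; intros [|t1 t2] H; cbn in H; unpack; f_equal; auto.
Qed.

Lemma code_var_inj G t (v : var G t) : forall t' (v' : var G t'),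
  code_var v = code_var v' -> existT _ t v = existT _ t' v'.
Proof.
  induction v; intros t' v' H; dependent destruction v'; cbn in H; unpack.
  - reflexivity.
  - specialize (IHv _ _ H). dependent destruction IHv. reflexivity.
Qed.

(** Stated with dependent pairs because the code also determines the type. The code of an
    application records its types, so that these are equated before the induction hypotheses are
    used. *)
Lemma code_term_inj G t (x : term G t) : forall t' (x' : term G t'),
  code_term x = code_term x' -> existT _ t x = existT _ t' x'.
Proof.
  induction x; intros t' x' H; destruct x'; cbn in H; unpack;
    repeat match goal with
    | H : code_ty _ = code_ty _ |- _ => apply code_ty_inj in H; subst
    end; try reflexivity.
  - match goal with H : code_var _ = _ |- _ => apply code_var_inj in H; dependent destruction H end.
    reflexivity.
  - apply IHx1 in H1. apply IHx2 in H2. apply inj_pair2 in H1, H2. subst. reflexivity.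
Qed.

(** Injectivity replaces a decoding function: the enumeration of tasks recovers a formula from its
    code by [epsilon]. *)
Lemma code_formula_inj G (A : formula G) : forall B : formula G,
  code_formula A = code_formula B -> A = B.
Proof.
  induction A; intros B H; dependent destruction B; cbn in H; unpack;
    repeat match goal with
    | H : code_ty _ = code_ty _ |- _ => apply code_ty_inj in H; subst
    | H : code_term _ = code_term _ |- _ =>
        apply code_term_inj in H; apply inj_pair2 in H; subst
    end; f_equal; auto.
Qed.

(** * Henkin models *)

Fixpoint env (D : ty -> Type) (G : ctx) : Type :=
  match G with [] => unit | s :: G' => (D s * env D G')%type end.

Fixpoint lookup {D : ty -> Type} {G t} (v : var G t) : env D G -> D t :=
  match v in var G t return env D G -> D t with
  | VZ => fst
  | VS w => fun e => lookup w (snd e)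
  end.

(** An applicative structure: the elements of an arrow type act as functions through [ap], but
    neither extensionality nor fullness is built in. *)
Record model : Type := {
  dom : ty -> Type;
  ap : forall s t, dom (s ⟶ t) -> dom s -> dom t;
  mlt : dom T0 -> dom T0 -> Prop;
  mzero : dom T0;
  mone : dom T0;
  mplus : dom (T0 ⟶ T0 ⟶ T0);
  mtimes : dom (T0 ⟶ T0 ⟶ T0);
  mK : forall s t, dom (s ⟶ t ⟶ s);
  mS : forall r s t, dom ((r ⟶ s ⟶ t) ⟶ (r ⟶ s) ⟶ r ⟶ t);
  mR : dom ((T0 ⟶ T0) ⟶ T0 ⟶ T0 ⟶ T0) }.
Arguments ap {m s t} f a.

Fixpoint eval (M : model) {G t} (x : term G t) (rho : env (dom M) G) : dom M t :=
  match x in term _ t return dom M t with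
  | Var v => lookup v rho
  | App f a => ap (eval f rho) (eval a rho)
  | Zero => mzero M
  | One => mone M
  | Plus => mplus M
  | Times => mtimes M
  | K => mK M _ _
  | S => mS M _ _ _
  | R0 => mR M
  end.

Fixpoint sat (M : model) {G} (A : formula G) : env (dom M) G -> Prop :=
  match A with
  | Eq0 x y => fun rho => eval x rho = eval y rho
  | Lt0 x y => fun rho => mlt (eval x rho) (eval y rho)
  | Bot => fun _ => False
  | And A B => fun rho => sat A rho /\ sat B rho
  | Or A B => fun rho => sat A rho \/ sat B rho
  | Imp A B => fun rho => sat A rho -> sat B rho
  | All s A => fun rho => forall x : dom M s, sat A (x, rho)
  | Ex s A => fun rho => exists x : dom M s, sat A (x, rho)
  end.

Definition extensional (M : model) : Prop :=
  forall s t (f g : dom M (s ⟶ t)), (forall x, ap f x = ap g x) -> f = g.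

(** Turns a term found at stage [n] into a sequence over all stages: from [n] on it is carried along
    by [step], and the values before [n] are filled with the defaults [d]. *)
Lemma extend_seq : forall n (P : nat -> Type) (d : forall m, P m)
  (step : forall m, P m -> P (Suc m)) (x : P n),
  exists f : forall m, P m, f n = x /\ forall m, n <= m -> f (Suc m) = step m (f m).
Proof.
  induction n as [|n IH]; intros P d step x.
  - exists (nat_rect P x step). auto.
  - destruct (IH (fun m => P (Suc m)) (fun m => d (Suc m)) (fun m => step (Suc m)) x)
      as (f & Hf & Hs).
    exists (fun m => match m with 0 => d 0 | Suc k => f k end). split; [exact Hf |].
    intros [|m] Hm; [lia | apply Hs; lia].
Qed.

Definition ty_of_code (n : nat) : ty := epsilon (inhabits T0) (fun t => code_ty t = n).

Lemma ty_of_codeK t : ty_of_code (code_ty t) = t.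
Proof.
  apply code_ty_inj. unfold ty_of_code.
  apply (epsilon_spec (inhabits T0) (fun u => code_ty u = code_ty t)). eauto.
Qed.

(** Stage [m] is devoted to the task with number [m], which names a stage
    [task_stage m], the type of an existential quantifier and the code of its
    body, a formula over the context of that stage. *)
Definition task_stage (m : nat) : nat := fst (of_nat m).
Definition stage_ty (m : nat) : ty := ty_of_code (fst (of_nat (snd (of_nat m)))).
Definition task_code (m : nat) : nat := snd (of_nat (snd (of_nat m))).

(** The pairing function dominates its first argument, so a task is never due before the stage whose
    context its formula lives in. *)
Lemma task_surj n s c : exists m,
  n <= m /\ task_stage m = n /\ stage_ty m = s /\ task_code m = c.
Proof.
  exists (pack n (pack (code_ty s) c)).
  unfold task_stage, stage_ty, task_code, pack. rewrite !cancel_of_to. cbn [fst snd].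
  rewrite !cancel_of_to. cbn [fst snd]. rewrite ty_of_codeK. repeat split.
  pose proof (to_nat_non_decreasing n (to_nat (code_ty s, c))). lia.
Qed.

(** The variable added by a stage is the Henkin constant for the task of that stage. *)
Fixpoint stage_ctx (m : nat) : ctx :=
  match m with 0 => [] | Suc k => stage_ty k :: stage_ctx k end.

Definition shift {G} s : sub G (s :: G) := fun _ v => Var (VS v).
Arguments shift {G} s _ _ /.

(** One formula followed through the stages from [k] on: each step only weakens it by the new
    variable, underneath the variable to be quantified. *)
Definition coherent s k (f : forall j, formula (s :: stage_ctx j)) : Prop :=
  forall j, k <= j -> f (Suc j) = fsubst (f j) (up (shift (stage_ty j)) s).

Lemma coherent_unique s k (f g : forall j, formula (s :: stage_ctx j)) :
  coherent k f -> coherent k g -> f k = g k -> forall j, k <= j -> f j = g j.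
Proof.
  intros Hf Hg E j Hj. induction Hj as [|j Hj IH]; [exact E |].
  rewrite Hf, Hg, IH by assumption. reflexivity.
Qed.

(** The named formula lives over the context of [task_stage m]; a coherent family transports it to
    stage [m]. If the number codes no formula there, the task is arbitrary, which does no harm. *)
Definition task (m : nat) : formula (stage_ty m :: stage_ctx m) :=
  epsilon (inhabits Bot) (fun B => exists f : forall j, formula (stage_ty m :: stage_ctx j),
    coherent (task_stage m) f /\ code_formula (f (task_stage m)) = task_code m /\ f m = B).

Lemma task_occurs s k (f : forall j, formula (s :: stage_ctx j)) :
  coherent k f ->
  exists m, k <= m /\
    existT (fun u => formula (u :: stage_ctx m)) s (f m) = existT _ (stage_ty m) (task m).
Proof.
  intros Hf. destruct (task_surj k s (code_formula (f k))) as (m & Hm & Hk & Hs & Hc).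
  exists m. split; [exact Hm |]. subst s. f_equal. unfold task.
  match goal with |- _ = epsilon ?i ?P =>
    destruct (epsilon_spec i P) as (g & Hg & Hgc & <-) end.
  - exists (f m), f. rewrite Hk. auto.
  - rewrite Hk in Hg, Hgc. rewrite Hc in Hgc. apply code_formula_inj in Hgc.
    apply coherent_unique with (k := k); auto.
Qed.

(** * A complete theory with witnesses *)

Section Henkin.

Variable T : theory.
Hypothesis T_closed : subst_closed T.
Hypothesis T_ext : forall G s t (x y : term G s) (f : term G (s ⟶ t)),
  T (EqT x y ⇒ EqT (f · x) (f · y)).
Variable start : formula [].
Hypothesis start_consistent : ~ deriv T [start] Bot.

Definition consistent G (H : list (formula G)) : Prop := ~ deriv T H Bot.

(** No type is empty: in a contradiction derived with one more variable, [OneT s] can be put for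
    that variable. *)
Lemma consistent_flift G (H : list (formula G)) s :
  consistent H -> consistent (map (flift s) H).
Proof.
  intros HH HB. apply HH.
  exact (d_allE (OneT s) (d_allI (A := Bot) HB)).
Qed.

(** If [E] is consistent with what has been assumed, its body is assumed of the newly added
    variable, which thereby becomes the witness; otherwise the negation of [E] is assumed. *)
Fixpoint stage (m : nat) : list (formula (stage_ctx m)) :=
  match m with
  | 0 => [start]
  | Suc k =>
      let E := Ex (stage_ty k) (task k) in
      if excluded_middle_informative (consistent (E :: stage k))
      then task k :: map (flift (stage_ty k)) (E :: stage k)
      else map (flift (stage_ty k)) ((¬ E) :: stage k)
  end.

Lemma stage_consistent m : consistent (stage m).
Proof.
  induction m as [|m IH]; [exact start_consistent |]. cbn [stage].
  destruct (excluded_middle_informative _) as [HE | HE].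
  - intros HB. apply HE. eapply d_exE; [apply d_hyp; left; reflexivity | exact HB].
  - apply consistent_flift. intros HB. apply HE. intros HB'. apply IH.
    eapply d_impE; [apply d_impI; exact HB | apply d_impI; exact HB'].
Qed.

Lemma stage_mono m A : deriv T (stage m) A -> deriv T (stage (Suc m)) (flift _ A).
Proof.
  intros HA. apply (deriv_flift T_closed (stage_ty m)) in HA.
  apply (deriv_weaken HA). cbn [stage].
  destruct (excluded_middle_informative _); intros B HB; [right; right | right]; exact HB.
Qed.

(** A term of the union of all stages: from some stage on the sequence consists of weakenings of one
    term, and its earlier values carry no information. *)
Definition elt (t : ty) : Type :=
  {f : forall m, term (stage_ctx m) t |
    exists n, forall m, n <= m -> f (Suc m) = tlift _ (f m)}.

Definition sub_at G (rho : env elt G) (m : nat) : sub G (stage_ctx m) :=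
  fun t v => proj1_sig (lookup v rho) m.

Lemma sub_at_coherent G (rho : env elt G) :
  exists n, forall m, n <= m -> sub_at rho (Suc m) = fun t v => tlift _ (sub_at rho m v).
Proof.
  induction G as [|s G IH].
  - exists 0. intros m _. apply sub_ext. intros t v. inversion v.
  - destruct rho as [[f [n1 Hf]] rho]. destruct (IH rho) as [n2 Hr].
    exists (n1 + n2)%nat. intros m Hm. apply sub_cons_ext; [apply Hf; lia |].
    intros t v. specialize (Hr m ltac:(lia)).
    exact (f_equal (fun th : sub _ _ => th t v) Hr).
Qed.

Definition true_in G (rho : env elt G) (A : formula G) : Prop :=
  exists n, forall m, n <= m -> deriv T (stage m) (fsubst A (sub_at rho m)).

Lemma stage_step G (A : formula G) m (th : sub G (stage_ctx m)) th' :
  th' = (fun t v => tlift (stage_ty m) (th t v)) ->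
  deriv T (stage m) (fsubst A th) -> deriv T (stage (Suc m)) (fsubst A th').
Proof. intros -> HA. rewrite <- (flift_fsubst A (stage_ty m) th). apply stage_mono, HA. Qed.

(** Once [sub_at rho] is coherent, derivability passes from each stage to the next, so a single late
    stage decides. *)
Lemma true_from_stage G (rho : env elt G) (A : formula G) :
  (forall n, exists m, n <= m /\ deriv T (stage m) (fsubst A (sub_at rho m))) -> true_in rho A.
Proof.
  intros H. destruct (sub_at_coherent rho) as [n Hn]. destruct (H n) as (m & Hm & HA).
  exists m. intros p Hp. induction Hp as [|p Hp IH]; [exact HA |].
  apply stage_step with (2 := IH), Hn. lia.
Qed.

Lemma true_mono1 G (rho : env elt G) (A B : formula G) :
  (forall m, deriv T (stage m) (fsubst A (sub_at rho m)) ->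
             deriv T (stage m) (fsubst B (sub_at rho m))) ->
  true_in rho A -> true_in rho B.
Proof. intros H [n HA]. exists n. auto. Qed.

Lemma true_mono2 G (rho : env elt G) (A B C : formula G) :
  (forall m, deriv T (stage m) (fsubst A (sub_at rho m)) ->
             deriv T (stage m) (fsubst B (sub_at rho m)) ->
             deriv T (stage m) (fsubst C (sub_at rho m))) ->
  true_in rho A -> true_in rho B -> true_in rho C.
Proof.
  intros H [n HA] [p HB]. exists (n + p)%nat. intros m Hm.
  apply H; [apply HA | apply HB]; lia.
Qed.

Lemma true_Bot G (rho : env elt G) : ~ true_in rho Bot.
Proof. intros [n H]. exact (stage_consistent (H n (le_n n))). Qed.

Lemma true_Neg_absurd G (rho : env elt G) A : true_in rho (¬ A) -> true_in rho A -> False.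
Proof.
  intros H1 H2. apply (@true_Bot G rho). revert H1 H2. apply true_mono2.
  intros m H1 H2. exact (d_impE H1 H2).
Qed.

Lemma flift_true G (rho : env elt G) s (x : elt s) A :
  @true_in (s :: G) (x, rho) (flift s A) <-> true_in rho A.
Proof.
  split; intros [n H]; exists n; intros m Hm; specialize (H m Hm);
    rewrite fsubst_flift in *; exact H.
Qed.

(** Completeness and the witness property at once. The body, under [rho], is a coherent family and
    so is the task of some stage, where the existential statement was either refuted or given a
    variable as witness. *)
Lemma henkin_witness G (rho : env elt G) s (A : formula (s :: G)) :
  true_in rho (¬ Ex s A) \/ exists x : elt s, @true_in (s :: G) (x, rho) A.
Proof.
  destruct (sub_at_coherent rho) as [n Hn].
  set (f := fun j => fsubst A (up (sub_at rho j) s)).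
  assert (Hf : forall k, n <= k -> coherent k f).
  { intros k Hk j Hj. unfold f. rewrite Hn, fsubst_comp by lia. f_equal.
    symmetry. apply up_comp. }
  destruct (classic (exists m, n <= m /\ deriv T (stage (Suc m))
                (fsubst (¬ Ex s A) (sub_at rho (Suc m))))) as [(m & Hm & HA) | HN].
  - left. exists (Suc m). intros p Hp. induction Hp as [|p Hp IH]; [exact HA |].
    apply stage_step with (2 := IH), Hn. lia.
  - right. destruct (task_occurs (Hf n (le_n n))) as (m & Hm & E).
    assert (exists x : term (stage_ctx (Suc m)) s,
      deriv T (stage (Suc m)) (fsubst A (scons x (sub_at rho (Suc m))))) as [x Hx].
    { destruct (excluded_middle_informative (consistent (Ex _ (task m) :: stage m))) as [HE|HE] eqn:Hdec.
      - clear HN. cbn [stage]. rewrite Hdec. rewrite (Hn m Hm).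
        unfold f in E. clear Hf Hdec. cbn beta in E.
        change (exists x : term (stage_ty m :: stage_ctx m) s,
          deriv T (task m :: map (flift (stage_ty m)) (Ex (stage_ty m) (task m) :: stage m))
            (fsubst A (scons x (fun t v => tlift (stage_ty m) (sub_at rho m v))))).
        (* Generalizing over the type and the body of the task allows the equation of dependent
           pairs to be eliminated; the new variable is then the witness. *)
        clear HE. revert E. generalize (task m). generalize (stage_ty m). intros u B E.
        injection E; intros _ ->. apply inj_pair2 in E. subst B.
        exists (Var VZ). apply d_hyp. left. reflexivity.
      - exfalso. apply HN. exists m. split; [exact Hm |].
        cbn [stage]. rewrite Hdec. rewrite (Hn m Hm), <- (flift_fsubst _ (stage_ty m) (sub_at rho m)).
        apply d_hyp. left. f_equal. cbn [fsubst]. f_equal.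
        exact (f_equal (fun p => Ex (projT1 p) (projT2 p)) (eq_sym E)). }
    (* The witness appears at stage [Suc m] and is weakened from there on; its earlier values are
       dummies. *)
    destruct (@extend_seq (Suc m) (fun j => term (stage_ctx j) s) (fun j => OneT s)
                (fun j => tlift (stage_ty j)) x) as (g & <- & Hg).
    assert (Hgc : exists n, forall m, n <= m -> g (Suc m) = tlift _ (g m)) by eauto.
    exists (exist _ g Hgc).
    exists (Suc m). intros p Hp. induction Hp as [|p Hp IH].
    + refine (eq_ind _ (fun th => deriv T (stage (Suc m)) (fsubst A th)) Hx _ _).
      apply sub_cons_ext; reflexivity.
    + apply stage_step with (2 := IH).
      apply sub_cons_ext; [apply Hg; exact Hp |].
      intros t v. assert (Hnp : n <= p) by lia.
      exact (f_equal (fun th : sub _ _ => th t v) (Hn p Hnp)).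
Qed.


Lemma true_Neg G (rho : env elt G) A : true_in rho (¬ A) <-> ~ true_in rho A.
Proof.
  split; [intros H1 H2; exact (true_Neg_absurd H1 H2) | intros HN].
  (* A vacuous quantifier turns the witness property into the decision of an arbitrary formula. *)
  destruct (henkin_witness rho (s := T0) (flift T0 A)) as [H | [x Hx]].
  - revert H. apply true_mono1. intros m H. apply d_impI.
    eapply d_impE; [apply (deriv_weaken H); right; assumption |].
    cbn [fsubst]. apply d_exI with (a := Zero). rewrite inst_up, fsubst_flift.
    apply d_hyp. left. reflexivity.
  - apply flift_true in Hx. contradiction.
Qed.

Lemma true_And G (rho : env elt G) A B :
  true_in rho (A ⩓ B) <-> true_in rho A /\ true_in rho B.
Proof.
  split.
  - intros H. split; revert H; apply true_mono1; intros m H;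
      [exact (d_andE1 H) | exact (d_andE2 H)].
  - intros [H1 H2]. revert H1 H2. apply true_mono2. intros m. apply d_andI.
Qed.

Lemma true_Or G (rho : env elt G) A B :
  true_in rho (A ⩔ B) <-> true_in rho A \/ true_in rho B.
Proof.
  split.
  - intros H. apply NNPP. intros HN. apply not_or_and in HN. destruct HN as [HA HB].
    apply true_Neg in HA, HB. apply (@true_Bot G rho).
    apply (true_mono2 (A := A ⩔ B) (B := ¬ A ⩓ ¬ B)); [| exact H | apply true_And; auto].
    intros m HAB HN. eapply d_orE; [exact HAB | |].
    + eapply d_impE; [eapply d_andE1, (deriv_weaken HN); right; assumption |].
      apply d_hyp; left; reflexivity.
    + eapply d_impE; [eapply d_andE2, (deriv_weaken HN); right; assumption |].
      apply d_hyp; left; reflexivity.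
  - intros [H | H]; revert H; apply true_mono1; intros m; [apply d_orI1 | apply d_orI2].
Qed.

Lemma true_Imp G (rho : env elt G) A B :
  true_in rho (A ⇒ B) <-> (true_in rho A -> true_in rho B).
Proof.
  split.
  - intros H HA. revert H HA. apply true_mono2. intros m. apply d_impE.
  - intros H. destruct (classic (true_in rho A)) as [HA | HA].
    + generalize (H HA). apply true_mono1. intros m HB. apply d_impI.
      apply (deriv_weaken HB). right; assumption.
    + apply true_Neg in HA. revert HA. apply true_mono1. intros m HN. apply d_impI, d_raa.
      eapply d_impE; [apply (deriv_weaken HN); right; right; assumption |].
      apply d_hyp. right; left; reflexivity.
Qed.

Lemma sub_at_cons G (rho : env elt G) s (x : elt s) m :
  @sub_at (s :: G) (x, rho) m = scons (proj1_sig x m) (sub_at rho m).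
Proof. apply sub_cons_ext; reflexivity. Qed.

Lemma true_Ex G (rho : env elt G) s (A : formula (s :: G)) :
  true_in rho (∃[s] A) <-> exists x : elt s, @true_in (s :: G) (x, rho) A.
Proof.
  split.
  - intros H. destruct (henkin_witness rho A) as [HN | Hx]; [| exact Hx].
    destruct (true_Neg_absurd HN H).
  - intros [x [n Hx]]. exists n. intros m Hm. specialize (Hx m Hm).
    rewrite sub_at_cons, <- inst_up in Hx. exact (d_exI Hx).
Qed.

Lemma deriv_not_all G (H : list (formula G)) s (A : formula (s :: G)) :
  deriv T H (¬ All s A) -> deriv T H (Ex s (¬ A)).
Proof.
  intros HN. apply d_raa. eapply d_impE; [apply (deriv_weaken HN); right; assumption |].
  apply d_allI, d_raa. eapply d_impE; [apply d_hyp; right; left; reflexivity |].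
  apply d_exI with (a := Var VZ).
  replace (inst _ _) with (¬ A); [apply d_hyp; left; reflexivity |].
  unfold inst. cbn [fsubst]. rewrite fsubst_comp. symmetry. f_equal.
  rewrite <- (fsubst_var A) at 2. f_equal. apply sub_cons_ext; reflexivity.
Qed.

Lemma true_All G (rho : env elt G) s (A : formula (s :: G)) :
  true_in rho (∀[s] A) <-> forall x : elt s, @true_in (s :: G) (x, rho) A.
Proof.
  split.
  - intros [n H] x. exists n. intros m Hm. rewrite sub_at_cons, <- inst_up.
    exact (d_allE (proj1_sig x m) (H m Hm)).
  - intros H. apply NNPP. intros HN. apply true_Neg in HN.
    assert (HE : true_in rho (∃[s] ¬ A)).
    { revert HN. apply true_mono1. intros m. exact (@deriv_not_all _ _ s _). }
    apply true_Ex in HE. destruct HE as [x Hx]. exact (true_Neg_absurd Hx (H x)).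
Qed.

(** * The quotient by provable equality and the truth lemma *)

Lemma elt_ext t (x y : elt t) : (forall m, proj1_sig x m = proj1_sig y m) -> x = y.
Proof.
  destruct x as [f Hf], y as [g Hg]. cbn. intros E.
  assert (f = g) as <- by (apply functional_extensionality_dep; exact E).
  f_equal. apply proof_irrelevance.
Qed.

Lemma eval_coherent G (rho : env elt G) t (x : term G t) :
  exists n, forall m, n <= m ->
    tsubst (sub_at rho (Suc m)) x = tlift _ (tsubst (sub_at rho m) x).
Proof.
  destruct (sub_at_coherent rho) as [n Hn]. exists n. intros m Hm.
  rewrite (Hn m Hm). unfold tlift. rewrite tsubst_comp. reflexivity.
Qed.

Definition eval_elt G (rho : env elt G) t (x : term G t) : elt t :=
  exist _ (fun m => tsubst (sub_at rho m) x) (eval_coherent rho x).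

Definition app_elt s t (f : elt (s ⟶ t)) (x : elt s) : elt t :=
  @eval_elt [s ⟶ t; s] (f, (x, tt)) t (v0 · v1).

Definition eq_elt t (x y : elt t) : Prop := @true_in [t; t] (x, (y, tt)) (EqT v0 v1).

Definition lt_elt (x y : elt T0) : Prop := @true_in [T0; T0] (x, (y, tt)) (v0 ≺ v1).

Lemma eval_elt_lookup G (rho : env elt G) t (v : var G t) :
  eval_elt rho (Var v) = lookup v rho.
Proof. apply elt_ext. reflexivity. Qed.

Lemma eval_elt_App G (rho : env elt G) s t (f : term G (s ⟶ t)) a :
  eval_elt rho (f · a) = app_elt (eval_elt rho f) (eval_elt rho a).
Proof. apply elt_ext. reflexivity. Qed.

Lemma eval_elt_tlift G (rho : env elt G) s (y : elt s) t (x : term G t) :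
  @eval_elt (s :: G) (y, rho) t (tlift s x) = eval_elt rho x.
Proof.
  apply elt_ext. intros m. cbn. unfold tlift. rewrite tsubst_comp. reflexivity.
Qed.

Lemma true_EqT G (rho : env elt G) t (x y : term G t) :
  true_in rho (EqT x y) <-> eq_elt (eval_elt rho x) (eval_elt rho y).
Proof.
  split; intros [n H]; exists n; intros m Hm; specialize (H m Hm);
    rewrite fsubst_EqT in *; exact H.
Qed.

Lemma true_Lt0 G (rho : env elt G) (x y : term G T0) :
  true_in rho (x ≺ y) <-> lt_elt (eval_elt rho x) (eval_elt rho y).
Proof. split; intros [n H]; exists n; exact H. Qed.

Lemma eq_elt_arrow s t (f g : elt (s ⟶ t)) :
  eq_elt f g <-> forall x, eq_elt (app_elt f x) (app_elt g x).
Proof.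
  unfold eq_elt at 1. cbn [EqT]. rewrite true_All.
  split; intros H x; specialize (H x); rewrite true_EqT in *;
    rewrite !eval_elt_App, !eval_elt_tlift, !eval_elt_lookup in *; exact H.
Qed.

Lemma deriv_eq_sym G (H : list (formula G)) (x y : term G T0) :
  deriv T H (x ≐ y) -> deriv T H (y ≐ x).
Proof.
  intros E. pose proof (@d_eqE T G H x y (v0 ≐ tlift T0 x) E) as HE.
  unfold inst in HE. cbn in HE. rewrite !tsubst_scons_tlift, !tsubst_var in HE.
  apply HE, d_eqI.
Qed.

Lemma deriv_eq_trans G (H : list (formula G)) (x y z : term G T0) :
  deriv T H (x ≐ y) -> deriv T H (y ≐ z) -> deriv T H (x ≐ z).
Proof.
  intros E1 E2. pose proof (@d_eqE T G H y z (tlift T0 x ≐ v0) E2) as HE.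
  unfold inst in HE. cbn in HE. rewrite !tsubst_scons_tlift, !tsubst_var in HE.
  apply HE, E1.
Qed.

Lemma deriv_lt_congr G (H : list (formula G)) (x x' y y' : term G T0) :
  deriv T H (x ≐ x') -> deriv T H (y ≐ y') -> deriv T H (x ≺ y) -> deriv T H (x' ≺ y').
Proof.
  intros E1 E2 HL. pose proof (@d_eqE T G H x x' (v0 ≺ tlift T0 y) E1) as H1.
  pose proof (@d_eqE T G H y y' (tlift T0 x' ≺ v0) E2) as H2.
  unfold inst in H1, H2. cbn in H1, H2. rewrite !tsubst_scons_tlift, !tsubst_var in *.
  auto.
Qed.

Lemma eq_elt_refl t (x : elt t) : eq_elt x x.
Proof.
  induction t; [exists 0; intros; apply d_eqI |].
  apply eq_elt_arrow. auto.
Qed.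

Lemma eq_elt_sym t (x y : elt t) : eq_elt x y -> eq_elt y x.
Proof.
  induction t.
  - intros [n H]. exists n. intros m Hm. exact (deriv_eq_sym (H m Hm)).
  - rewrite !eq_elt_arrow. auto.
Qed.

Lemma eq_elt_trans t (x y z : elt t) : eq_elt x y -> eq_elt y z -> eq_elt x z.
Proof.
  induction t.
  - intros [n H] [p H']. exists (n + p)%nat. intros m Hm.
    eapply deriv_eq_trans; [apply H | apply H']; lia.
  - rewrite !eq_elt_arrow. intros Hxy Hyz a. eauto.
Qed.

Lemma lt_elt_congr (x x' y y' : elt T0) :
  eq_elt x x' -> eq_elt y y' -> lt_elt x y -> lt_elt x' y'.
Proof.
  intros [n1 H1] [n2 H2] [n3 H3]. exists (n1 + n2 + n3)%nat. intros m Hm.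
  eapply deriv_lt_congr; [apply H1 | apply H2 | apply H3]; lia.
Qed.

(** Exchanging the argument is the axiom of extensionality; exchanging the function is the pointwise
    meaning of equality at an arrow type. *)
Lemma app_elt_congr s t (f g : elt (s ⟶ t)) (x y : elt s) :
  eq_elt f g -> eq_elt x y -> eq_elt (app_elt f x) (app_elt g y).
Proof.
  intros Hf Hx. apply eq_elt_trans with (app_elt f y).
  - destruct Hx as [n Hx]. exists n. intros m Hm. rewrite fsubst_EqT.
    eapply d_impE; [apply d_ax, T_ext |].
    specialize (Hx m Hm). rewrite fsubst_EqT in Hx. exact Hx.
  - apply eq_elt_arrow. exact Hf.
Qed.

Definition eq_env G (rho rho' : env elt G) : Prop :=
  forall t (v : var G t), eq_elt (lookup v rho) (lookup v rho').

Lemma eq_env_sym G (rho rho' : env elt G) : eq_env rho rho' -> eq_env rho' rho.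
Proof. intros H t v. apply eq_elt_sym, H. Qed.

Lemma eq_env_cons G (rho rho' : env elt G) s (x y : elt s) :
  eq_env rho rho' -> eq_elt x y -> @eq_env (s :: G) (x, rho) (y, rho').
Proof. intros H Hx. refine (var_cons_ind _ _); [exact Hx | exact H]. Qed.

Lemma eval_elt_congr G (rho rho' : env elt G) : eq_env rho rho' ->
  forall t (x : term G t), eq_elt (eval_elt rho x) (eval_elt rho' x).
Proof.
  intros H. induction x; try (rewrite !eval_elt_lookup; apply H);
    try (rewrite !eval_elt_App; apply app_elt_congr; assumption);
    match goal with |- eq_elt ?a ?b =>
      replace b with a by (apply elt_ext; reflexivity); apply eq_elt_refl end.
Qed.

Lemma true_congr G (A : formula G) : forall rho rho' : env elt G,
  eq_env rho rho' -> true_in rho A -> true_in rho' A.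
Proof.
  induction A; intros rho rho' H.
  - change (t ≐ t0) with (EqT t t0). rewrite !true_EqT. intros HE.
    apply eq_elt_trans with (eval_elt rho t); [apply eval_elt_congr, eq_env_sym, H |].
    apply eq_elt_trans with (eval_elt rho t0); [exact HE | apply eval_elt_congr, H].
  - rewrite !true_Lt0. apply lt_elt_congr; apply eval_elt_congr, H.
  - intros HB. destruct (true_Bot HB).
  - rewrite !true_And. intros [H1 H2]. eauto.
  - rewrite !true_Or. intros [H1 | H2]; eauto.
  - rewrite !true_Imp. intros H1 H2.
    apply (IHA2 _ _ H), H1, (IHA1 _ _ (eq_env_sym H)), H2.
  - rewrite !true_All. intros H1 x.
    apply (IHA (x, rho) (x, rho')), H1. apply eq_env_cons; [exact H | apply eq_elt_refl].
  - rewrite !true_Ex. intros [x H1]. exists x.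
    apply (IHA (x, rho) (x, rho')), H1. apply eq_env_cons; [exact H | apply eq_elt_refl].
Qed.

(** A chosen representative of the class of [x]. Equivalent elements have equal classes as
    predicates, hence the same representative, and the quotient can be taken as a subtype. *)
Definition canon t (x : elt t) : elt t := epsilon (inhabits x) (eq_elt x).

Lemma canon_eq t (x : elt t) : eq_elt x (canon x).
Proof. apply (epsilon_spec (inhabits x) (eq_elt x)). exists x. apply eq_elt_refl. Qed.

Lemma canon_congr t (x y : elt t) : eq_elt x y -> canon x = canon y.
Proof.
  intros H. unfold canon. replace (eq_elt y) with (eq_elt x).
  - f_equal. apply proof_irrelevance.
  - apply functional_extensionality. intros z. apply propositional_extensionality.
    split; apply eq_elt_trans; [apply eq_elt_sym |]; exact H.
Qed.

Definition quo (t : ty) : Type := {x : elt t | canon x = x}.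
Definition rep t (q : quo t) : elt t := proj1_sig q.
Definition cls t (x : elt t) : quo t :=
  exist _ (canon x) (canon_congr (eq_elt_sym (canon_eq x))).

Lemma cls_eq t (x y : elt t) : eq_elt x y -> cls x = cls y.
Proof. intros H. apply eq_sig_hprop; [intros; apply proof_irrelevance |]. apply canon_congr, H. Qed.

Lemma rep_cls t (x : elt t) : eq_elt x (rep (cls x)).
Proof. apply canon_eq. Qed.

Lemma cls_rep t (q : quo t) : cls (rep q) = q.
Proof.
  apply eq_sig_hprop; [intros; apply proof_irrelevance |]. exact (proj2_sig q).
Qed.

Lemma rep_eq t (p q : quo t) : eq_elt (rep p) (rep q) -> p = q.
Proof. intros H. rewrite <- (cls_rep p), <- (cls_rep q). apply cls_eq, H. Qed.

Definition henkin_model : model := {|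
  dom := quo;
  ap := fun s t f a => cls (app_elt (rep f) (rep a));
  mlt := fun x y => lt_elt (rep x) (rep y);
  mzero := cls (@eval_elt [] tt _ Zero);
  mone := cls (@eval_elt [] tt _ One);
  mplus := cls (@eval_elt [] tt _ Plus);
  mtimes := cls (@eval_elt [] tt _ Times);
  mK := fun s t => cls (@eval_elt [] tt _ (@K _ s t));
  mS := fun r s t => cls (@eval_elt [] tt _ (@S _ r s t));
  mR := cls (@eval_elt [] tt _ R0) |}.

Fixpoint reps G : env quo G -> env elt G :=
  match G with
  | [] => fun _ => tt
  | s :: G' => fun rho => (rep (fst rho), reps (snd rho))
  end.

Lemma lookup_reps G t (v : var G t) : forall rho : env quo G,
  lookup v (reps rho) = rep (lookup v rho).
Proof. induction v; intros rho; [reflexivity | apply IHv]. Qed.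

Lemma eval_henkin G t (x : term G t) (rho : env quo G) :
  @eval henkin_model G t x rho = cls (eval_elt (reps rho) x).
Proof.
  induction x; cbn [eval]; try (apply cls_eq;
    match goal with |- eq_elt ?a ?b =>
      replace b with a by (apply elt_ext; reflexivity); apply eq_elt_refl end).
  - rewrite eval_elt_lookup, lookup_reps, cls_rep. reflexivity.
  - rewrite IHx1, IHx2, eval_elt_App. apply cls_eq.
    apply app_elt_congr; apply eq_elt_sym, rep_cls.
Qed.

Lemma sat_henkin G (A : formula G) : forall rho : env quo G,
  @sat henkin_model G A rho <-> true_in (reps rho) A.
Proof.
  induction A; intros rho; cbn [sat].
  - change (t ≐ t0) with (EqT t t0). rewrite true_EqT, !eval_henkin. split.
    + intros E. apply (f_equal (@rep T0)) in E.
      apply eq_elt_trans with (1 := rep_cls _). rewrite E. apply eq_elt_sym, rep_cls.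
    + apply cls_eq.
  - rewrite true_Lt0, !eval_henkin. cbn [mlt henkin_model].
    split; apply lt_elt_congr; try apply rep_cls; apply eq_elt_sym, rep_cls.
  - split; [contradiction | apply true_Bot].
  - rewrite true_And, IHA1, IHA2. reflexivity.
  - rewrite true_Or, IHA1, IHA2. reflexivity.
  - rewrite true_Imp, IHA1, IHA2. reflexivity.
  - rewrite true_All. split; intros H x.
    + specialize (H (cls x)). apply IHA in H. revert H. apply true_congr.
      apply eq_env_cons; [intros u v; apply eq_elt_refl | apply eq_elt_sym, rep_cls].
    + apply IHA. apply H.
  - rewrite true_Ex. split; intros [x H].
    + exists (rep x). apply IHA in H. exact H.
    + exists (cls x). apply IHA. revert H. apply true_congr.
      apply eq_env_cons; [intros u v; apply eq_elt_refl | apply rep_cls].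
Qed.

Lemma henkin_extensional : extensional henkin_model.
Proof.
  intros s t f g H. apply rep_eq, eq_elt_arrow. intros x.
  assert (H' : rep (cls (app_elt (rep f) (rep (cls x)))) = rep (cls (app_elt (rep g) (rep (cls x)))))
    by exact (f_equal (@rep t) (H (cls x))). clear H.
  assert (E : forall h : quo (s ⟶ t),
    eq_elt (app_elt (rep h) x) (rep (cls (app_elt (rep h) (rep (cls x)))))).
  { intros h. apply eq_elt_trans with (2 := rep_cls _).
    apply app_elt_congr; [apply eq_elt_refl | apply rep_cls]. }
  apply eq_elt_trans with (1 := E f). rewrite H'. apply eq_elt_sym, E.
Qed.

Lemma start_true : @sat henkin_model [] start tt.
Proof.
  apply sat_henkin, true_from_stage. cbn [reps].
  destruct (sub_at_coherent (G := []) tt) as [n0 Hn0].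
  assert (H : forall m, deriv T (stage m) (fsubst start (@sub_at [] tt m))).
  { induction m as [|m IH].
    - replace (@sub_at [] tt 0) with (fun t (v : var [] t) => Var v)
        by (apply sub_ext; intros t v; inversion v).
      rewrite fsubst_var. apply d_hyp. left. reflexivity.
    - apply stage_step with (2 := IH). apply sub_ext. intros t v. inversion v. }
  intros n. exists n. auto.
Qed.

Lemma henkin_sound G (A : formula G) : T A -> forall rho, @sat henkin_model G A rho.
Proof.
  intros HA rho. apply sat_henkin. exists 0. intros m _. apply d_ax, T_closed, HA.
Qed.

End Henkin.

(** If [A] is not derivable, then by reductio its negation is consistent, and the Henkin model
    started from that negation refutes [A]. *)
Theorem completeness (T : theory) (A : formula []) :
  subst_closed T ->
  (forall G s t (x y : term G s) (f : term G (s ⟶ t)),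
     T _ (EqT x y ⇒ EqT (f · x) (f · y))) ->
  (forall M : model, extensional M ->
     (forall G (B : formula G), T G B -> forall rho, @sat M G B rho) -> @sat M [] A tt) ->
  T ⊢ A.
Proof.
  intros Hc He H. unfold proves. apply NNPP. intros HN.
  assert (Hstart : ~ deriv T [¬ A] Bot) by (intros HB; apply HN, d_raa, HB).
  pose proof (start_true Hc He Hstart) as Hs. apply Hs.
  apply H; [apply henkin_extensional | apply henkin_sound]; assumption.
Qed.

(** * Models of the base theory *)

Lemma OrderedSemiring_closed : subst_closed OrderedSemiring.
Proof.
  intros G A D th HA. destruct HA; cbn; rewrite ?tsubst_up_tlift; constructor.
Qed.

Lemma qf_fsubst G (A : formula G) : forall D (th : sub G D), qf A -> qf (fsubst A th).
Proof. induction A; cbn; intuition. Qed.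

Lemma QF_AC_closed s t : subst_closed (QF_AC s t).
Proof.
  intros G B D th HB. destruct HB as [G A HA].
  replace (fsubst _ th) with
    ((∀[s] ∃[t] fsubst A (up (up th s) t)) ⇒
     ∃[s ⟶ t] ∀[s] fsubst (fsubst A (up (up th s) t)) skolem_sub).
  - constructor. apply qf_fsubst, HA.
  - cbn. do 3 f_equal. rewrite !fsubst_comp. f_equal.
    apply sub_cons_ext; [reflexivity | intros u v; revert u v].
    refine (var_cons_ind _ _); [reflexivity | intros u v; cbn].
    unfold tlift. rewrite !tsubst_comp. reflexivity.
Qed.

Lemma RCA_basic_closed : subst_closed RCA_basic.
Proof.
  intros G B D th HB. destruct HB; cbn; rewrite ?fsubst_EqT; try (constructor; fail).
  - apply ax_semiring, OrderedSemiring_closed; assumption.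
  - rewrite fsubst_inst.
    replace (fsubst (fsubst A succ_sub) (up th T0)) with (fsubst (fsubst A (up th T0)) succ_sub).
    + apply ax_qf_ind with (A := fsubst A (up th T0)), qf_fsubst; assumption.
    + rewrite !fsubst_comp. f_equal. apply sub_cons_ext; [reflexivity | intros u v; cbn].
      unfold tlift. rewrite !tsubst_comp. reflexivity.
Qed.

Lemma tunion_closed T U : subst_closed T -> subst_closed U -> subst_closed (T ⊕ U).
Proof. intros HT HU G A D th [H | H]; [left; apply HT | right; apply HU]; exact H. Qed.

Lemma RCA0w_closed : subst_closed RCA0w.
Proof. apply tunion_closed; [apply RCA_basic_closed | apply QF_AC_closed]. Qed.

Lemma WKL_ax_closed : subst_closed WKL_ax.
Proof. intros G A D th HA. revert D th. destruct HA. constructor. Qed.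

(** * Arithmetic in an extensional model of the base theory *)

Section Model.

Variable M : model.
Hypothesis M_ext : extensional M.
Hypothesis M_RCA : forall G (A : formula G), RCA0w A -> forall rho, @sat M G A rho.

Local Notation D := (dom M).
Local Notation N := (dom M T0).
Local Notation "f @ a" := (ap f a) (at level 38, left associativity).

Lemma eval_tlift G s t (x : term G t) (a : D s) (rho : env D G) :
  @eval M (s :: G) t (tlift s x) (a, rho) = eval x rho.
Proof. induction x; cbn; try reflexivity. rewrite <- IHx1, <- IHx2. reflexivity. Qed.

Lemma sat_EqT t : forall G (x y : term G t) (rho : env D G),
  sat (EqT x y) rho <-> eval x rho = eval y rho.
Proof.
  induction t; intros G x y rho; [reflexivity |]. cbn [EqT sat]. split.
  - intros H. apply M_ext. intros a. specialize (H a). apply IHt2 in H.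
    cbn [eval] in H. rewrite !eval_tlift in H. exact H.
  - intros H a. apply IHt2. cbn [eval]. rewrite !eval_tlift, H. reflexivity.
Qed.

Lemma M_basic G (A : formula G) : RCA_basic A -> forall rho, @sat M G A rho.
Proof. intros H. apply M_RCA. left; exact H. Qed.

Lemma M_semiring G (A : formula G) : OrderedSemiring A -> forall rho, @sat M G A rho.
Proof. intros H. apply M_basic, ax_semiring, H. Qed.

Lemma ap_K s t (x : D s) (y : D t) : (mK M s t) @ x @ y = x.
Proof.
  pose proof (M_basic (@ax_K [s; t] s t v0 v1) (x, (y, tt))) as H.
  apply sat_EqT in H. exact H.
Qed.

Lemma ap_S r s t (x : D (r ⟶ s ⟶ t)) (y : D (r ⟶ s)) (z : D r) :
  (mS M r s t) @ x @ y @ z = x @ z @ (y @ z).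
Proof.
  pose proof (M_basic (@ax_S [r ⟶ s ⟶ t; r ⟶ s; r] r s t v0 v1 v2) (x, (y, (z, tt)))) as H.
  apply sat_EqT in H. exact H.
Qed.

Definition add (x y : N) : N := (mplus M) @ x @ y.
Definition mul (x y : N) : N := (mtimes M) @ x @ y.
Definition iter (f : D T1) (m n : N) : N := (mR M) @ f @ m @ n.
Definition le (x y : N) : Prop := mlt x y \/ x = y.

Declare Scope model_scope.
Local Open Scope model_scope.
Local Notation "0" := (mzero M) : model_scope.
Local Notation "1" := (mone M) : model_scope.
Local Infix "+" := add : model_scope.
Local Infix "*" := mul : model_scope.
Local Infix "<" := (@mlt M) : model_scope.
Local Infix "<=" := le : model_scope.

Lemma iter_0 f m : iter f m 0 = m.
Proof. exact (M_basic (@ax_R0_zero [T1; T0] v0 v1) (f, (m, tt))). Qed.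
Lemma iter_S f m n : iter f m (n + 1) = f @ (iter f m n).
Proof. exact (M_basic (@ax_R0_succ [T1; T0; T0] v0 v1 v2) (f, (m, (n, tt)))). Qed.

Lemma addA x y z : (x + y) + z = x + (y + z).
Proof. exact (M_semiring (@plus_assoc [T0; T0; T0] v0 v1 v2) (x, (y, (z, tt)))). Qed.
Lemma addC x y : x + y = y + x.
Proof. exact (M_semiring (@plus_comm [T0; T0] v0 v1) (x, (y, tt))). Qed.
Lemma addx0 x : x + 0 = x.
Proof. exact (M_semiring (@plus_zero [T0] v0) (x, tt)). Qed.
Lemma mulA x y z : (x * y) * z = x * (y * z).
Proof. exact (M_semiring (@times_assoc [T0; T0; T0] v0 v1 v2) (x, (y, (z, tt)))). Qed.
Lemma mulC x y : x * y = y * x.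
Proof. exact (M_semiring (@times_comm [T0; T0] v0 v1) (x, (y, tt))). Qed.
Lemma mulx0 x : x * 0 = 0.
Proof. exact (M_semiring (@times_zero [T0] v0) (x, tt)). Qed.
Lemma mulx1 x : x * 1 = x.
Proof. exact (M_semiring (@times_one [T0] v0) (x, tt)). Qed.
Lemma mulDr x y z : x * (y + z) = x * y + x * z.
Proof. exact (M_semiring (@distr [T0; T0; T0] v0 v1 v2) (x, (y, (z, tt)))). Qed.
Lemma lt_irr x : ~ x < x.
Proof. exact (M_semiring (@lt_irrefl [T0] v0) (x, tt)). Qed.
Lemma lt_tr x y z : x < y -> y < z -> x < z.
Proof. exact (M_semiring (@lt_trans [T0; T0; T0] v0 v1 v2) (x, (y, (z, tt)))). Qed.
Lemma lt_tot x y : x < y \/ x = y \/ y < x.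
Proof. exact (M_semiring (@lt_total [T0; T0] v0 v1) (x, (y, tt))). Qed.
Lemma lt_add2r x y z : x < y -> x + z < y + z.
Proof. exact (M_semiring (@lt_plus [T0; T0; T0] v0 v1 v2) (x, (y, (z, tt)))). Qed.
Lemma lt_mul2r x y z : 0 < z -> x < y -> x * z < y * z.
Proof. exact (M_semiring (@lt_times [T0; T0; T0] v0 v1 v2) (x, (y, (z, tt)))). Qed.
Lemma lt_ex_diff x y : x < y -> exists d, x + d = y.
Proof. exact (M_semiring (@lt_diff [T0; T0] v0 v1) (x, (y, tt))). Qed.
Lemma lt01 : 0 < 1.
Proof. exact (M_semiring (@lt_zero_one []) tt). Qed.
Lemma le1_pos x : 0 < x -> 1 <= x.
Proof. exact (M_semiring (@lt_discrete [T0] v0) (x, tt)). Qed.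
Lemma le0x x : 0 <= x.
Proof. exact (M_semiring (@le_zero [T0] v0) (x, tt)). Qed.

Lemma add0x x : 0 + x = x.
Proof. rewrite addC. apply addx0. Qed.

Lemma N_semiring : semi_ring_theory 0 1 add mul (@eq N).
Proof.
  constructor; intros; rewrite ?add0x, ?(mulC 1), ?mulx1, ?(mulC 0), ?mulx0, ?addA, ?mulA;
    auto using addC, mulC.
  rewrite mulC, mulDr, !(mulC p). reflexivity.
Qed.
Add Ring N_ring : N_semiring.

Lemma le_refl x : x <= x. Proof. right; reflexivity. Qed.
Lemma le_lt_tr x y z : x <= y -> y < z -> x < z.
Proof. intros [H | ->] H'; [exact (lt_tr H H') | exact H']. Qed.
Lemma lt_le_tr x y z : x < y -> y <= z -> x < z.
Proof. intros H [H' | <-]; [exact (lt_tr H H') | exact H]. Qed.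
Lemma le_tr x y z : x <= y -> y <= z -> x <= z.
Proof. intros H [H' | <-]; [left; exact (le_lt_tr H H') | exact H]. Qed.
Lemma lt_le x y : x < y -> x <= y. Proof. left; assumption. Qed.
Lemma lt_or_le x y : x < y \/ y <= x.
Proof. destruct (lt_tot x y) as [H | [H | H]]; unfold le; auto. Qed.
Lemma lt_not_le x y : x < y -> ~ y <= x.
Proof. intros H H'. exact (lt_irr (lt_le_tr H H')). Qed.
Lemma not_lt x y : ~ x < y -> y <= x.
Proof. destruct (lt_or_le x y); tauto. Qed.
Lemma le_antisym x y : x <= y -> y <= x -> x = y.
Proof. intros [H | H] H'; [destruct (lt_not_le H H') | exact H]. Qed.
Lemma not_lt0 x : ~ x < 0.
Proof. intros H. exact (lt_not_le H (le0x x)). Qed.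
Lemma le0 x : x <= 0 -> x = 0.
Proof. intros [H | H]; [destruct (not_lt0 H) | exact H]. Qed.
Lemma pos_or_0 x : x = 0 \/ 0 < x.
Proof. destruct (le0x x); auto. Qed.
Lemma pos_neq0 x : 0 < x <-> x <> 0.
Proof.
  split; [intros H -> ; exact (lt_irr H) |].
  intros H. destruct (pos_or_0 x); tauto.
Qed.
Lemma neq10 : 1 <> 0.
Proof. apply pos_neq0, lt01. Qed.
Lemma le_add2r x y z : x <= y -> x + z <= y + z.
Proof. intros [H | ->]; [left; apply lt_add2r, H | apply le_refl]. Qed.
Lemma le_add x y x' y' : x <= x' -> y <= y' -> x + y <= x' + y'.
Proof.
  intros H H'. apply le_tr with (x' + y); [apply le_add2r, H |].
  rewrite !(addC x'). apply le_add2r, H'.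
Qed.
Lemma le_mul2r x y z : x <= y -> x * z <= y * z.
Proof.
  intros [H | ->]; [| apply le_refl]. destruct (pos_or_0 z) as [-> | Hz].
  - rewrite !mulx0. apply le_refl.
  - left. apply lt_mul2r; assumption.
Qed.
Lemma le_mul x y x' y' : x <= x' -> y <= y' -> x * y <= x' * y'.
Proof.
  intros H H'. apply le_tr with (x' * y); [apply le_mul2r, H |].
  rewrite !(mulC x'). apply le_mul2r, H'.
Qed.
Lemma le_addr x d : x <= x + d.
Proof. rewrite <- (addx0 x) at 1. apply le_add; [apply le_refl | apply le0x]. Qed.
Lemma le_addl x d : x <= d + x.
Proof. rewrite addC. apply le_addr. Qed.
Lemma le_ex_diff x y : x <= y -> exists d, x + d = y.
Proof. intros [H | ->]; [apply lt_ex_diff, H | exists 0; apply addx0]. Qed.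
Lemma lt_add2r_inv x y z : x + z < y + z -> x < y.
Proof.
  intros H. destruct (lt_or_le x y) as [H' | H']; [exact H' |].
  destruct (lt_not_le H (le_add2r z H')).
Qed.
Lemma add_cancel_r x y z : x + z = y + z -> x = y.
Proof.
  intros H. destruct (lt_tot x y) as [H' | [H' | H']]; [| exact H' |];
    apply (lt_add2r z) in H'; rewrite H in H'; destruct (lt_irr H').
Qed.
Lemma add_cancel_l x y z : z + x = z + y -> x = y.
Proof. rewrite !(addC z). apply add_cancel_r. Qed.
Lemma lt_S x : x < x + 1.
Proof. rewrite <- (add0x x) at 1. rewrite (addC x). apply lt_add2r, lt01. Qed.
Lemma lt_leS x y : x < y <-> x + 1 <= y.
Proof.
  split; intros H.
  - destruct (lt_ex_diff H) as [d <-]. destruct (pos_or_0 d) as [-> | Hd].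
    + rewrite addx0 in H. destruct (lt_irr H).
    + rewrite !(addC x). apply le_add2r, le1_pos, Hd.
  - exact (lt_le_tr (lt_S x) H).
Qed.
Lemma lt_S_le x y : x < y + 1 <-> x <= y.
Proof.
  rewrite lt_leS. split; [| apply le_add2r].
  intros [H | H]; [left; exact (lt_add2r_inv H) | right; exact (add_cancel_r H)].
Qed.
Lemma lt_S_cases x y : x < y + 1 <-> x < y \/ x = y.
Proof. apply lt_S_le. Qed.
Lemma S_neq0 x : x + 1 <> 0.
Proof. apply pos_neq0, lt_S_le, le0x. Qed.
Lemma add_eq0 x y : x + y = 0 <-> x = 0 /\ y = 0.
Proof.
  split; [| intros [-> ->]; apply addx0]. intros H.
  split; apply le0; rewrite <- H; [apply le_addr | apply le_addl].
Qed.
Lemma mul_eq0 x y : x * y = 0 <-> x = 0 \/ y = 0.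
Proof.
  split; [| intros [-> | ->]; ring].
  intros H. destruct (pos_or_0 x) as [| Hx]; [auto |].
  destruct (pos_or_0 y) as [| Hy]; [auto |].
  apply (lt_mul2r Hy) in Hx. rewrite H in Hx. replace (0 * y) with 0 in Hx by ring.
  destruct (lt_irr Hx).
Qed.

(** ** Explicit definability *)

Fixpoint curry (G : ctx) (t : ty) : ty :=
  match G with [] => t | s :: G' => curry G' (s ⟶ t) end.

Fixpoint ap_env G : forall t, D (curry G t) -> env D G -> D t :=
  match G return forall t, D (curry G t) -> env D G -> D t with
  | [] => fun t x _ => x
  | s :: G' => fun t x rho => (ap_env (t := s ⟶ t) x (snd rho)) @ (fst rho)
  end.

(** Functions of the environment that are represented by an element of the model, the innermost
    variable being its last argument. The closure lemmas below amount to combinatory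
    completeness. *)
Definition definable G t (F : env D G -> D t) : Prop :=
  exists x : D (curry G t), forall rho, ap_env x rho = F rho.

Lemma definable_const G t (c : D t) : @definable G t (fun _ => c).
Proof.
  revert t c. induction G as [|s G IH]; intros t c; [exists c; reflexivity |].
  destruct (IH _ ((mK M t s) @ c)) as [x Hx]. exists x. intros rho.
  cbn. rewrite Hx. apply ap_K.
Qed.

(** Bracket abstraction: [S] distributes the innermost variable over the application, and the
    induction hypothesis, used for both arguments of [S], deals with the other variables. *)
Lemma definable_ap G s t (F : env D G -> D (s ⟶ t)) (A : env D G -> D s) :
  definable F -> definable A -> definable (fun rho => (F rho) @ (A rho)).
Proof.
  revert s t F A. induction G as [|r G IH]; intros s t F A [x Hx] [y Hy].
  - exists (x @ y). intros rho. cbn in *. rewrite <- Hx, <- Hy. reflexivity.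
  - destruct (IH _ _ _ _ (IH _ _ _ _ (definable_const G (mS M r s t)) (ex_intro _ x (fun _ => eq_refl)))
                (ex_intro _ y (fun _ => eq_refl))) as [z Hz].
    exists z. intros rho. cbn in *. rewrite Hz, ap_S, <- Hx, <- Hy. reflexivity.
Qed.

(** [S K K] is the identity combinator. *)
Lemma definable_fst G s : @definable (s :: G) s fst.
Proof.
  destruct (definable_const G ((mS M s (s ⟶ s) s) @ (mK M s (s ⟶ s)) @ (mK M s s))) as [x Hx].
  exists x. intros rho. cbn. rewrite Hx, ap_S, ap_K. reflexivity.
Qed.

Lemma definable_snd G s t (F : env D G -> D t) :
  definable F -> @definable (s :: G) t (fun rho => F (snd rho)).
Proof.
  intros HF. destruct (definable_ap (definable_const G (mK M t s)) HF) as [x Hx].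
  exists x. intros rho. cbn. rewrite Hx. apply ap_K.
Qed.

Lemma definable_lookup G t (v : var G t) : definable (lookup v).
Proof. induction v; [apply definable_fst | apply (definable_snd s IHv)]. Qed.

Lemma definable_fun1 s t (F : D s -> D t) :
  @definable [s] t (fun r => F (fst r)) -> exists f, forall x, f @ x = F x.
Proof. intros [f Hf]. exists f. intros x. exact (Hf (x, tt)). Qed.

Lemma definable_fun2 r s t (F : D r -> D s -> D t) :
  @definable [s; r] t (fun e => F (fst (snd e)) (fst e)) ->
  exists f, forall x y, f @ x @ y = F x y.
Proof. intros [f Hf]. exists f. intros x y. exact (Hf (y, (x, tt))). Qed.

Lemma definable_fun3 q r s t (F : D q -> D r -> D s -> D t) :
  @definable [s; r; q] t (fun e => F (fst (snd (snd e))) (fst (snd e)) (fst e)) ->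
  exists f, forall x y z, f @ x @ y @ z = F x y z.
Proof. intros [f Hf]. exists f. intros x y z. exact (Hf (z, (y, (x, tt)))). Qed.

Lemma definable_add G (x y : env D G -> N) :
  definable x -> definable y -> definable (fun r => x r + y r).
Proof. intros Hx Hy. repeat apply definable_ap; auto using definable_const. Qed.
Lemma definable_mul G (x y : env D G -> N) :
  definable x -> definable y -> definable (fun r => x r * y r).
Proof. intros Hx Hy. repeat apply definable_ap; auto using definable_const. Qed.
Lemma definable_iter G (f : env D G -> D T1) (m n : env D G -> N) :
  definable f -> definable m -> definable n -> definable (fun r => iter (f r) (m r) (n r)).
Proof. intros Hf Hm Hn. repeat apply definable_ap; auto using definable_const. Qed.

(** The two numbers [x] and [y] are passed to the choice functional, whose
    argument has type 1, as the values at 0 and 1 of a function. *)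
Lemma ex_monus : exists f : D (T0 ⟶ T0 ⟶ T0), forall x y,
  x < y /\ f @ x @ y = 0 \/ y + f @ x @ y = x.
Proof.
  pose (A := ((v1 · Zero ≺ v1 · One ⩓ v0 ≐ Zero) ⩔ v1 · One + v0 ≐ v1 · Zero)%ho : formula [T0; T1]).
  assert (HA : qf A) by (cbn; tauto).
  pose proof (@M_RCA [] _ (or_intror (@qf_ac T1 T0 [] A HA)) tt) as H. cbn in H.
  destruct H as [Y HY].
  { intros f. destruct (lt_or_le (f @ 0) (f @ 1)) as [H | H]; [exists 0; auto |].
    destruct (le_ex_diff H) as [d Hd]. exists d. right. exact Hd. }
  destruct (@definable_fun2 T0 T0 T0 (fun x y => Y @ ((mR M) @ ((mK M T0 T0) @ y) @ x))) as [f Hf].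
  { repeat apply definable_ap;
      auto using definable_const, definable_fst, definable_snd. }
  exists f. intros x y. rewrite Hf. specialize (HY ((mR M) @ ((mK M T0 T0) @ y) @ x)).
  assert (E0 : (mR M) @ ((mK M T0 T0) @ y) @ x @ 0 = x) by apply iter_0.
  assert (E1 : (mR M) @ ((mK M T0 T0) @ y) @ x @ 1 = y).
  { change (iter ((mK M T0 T0) @ y) x 1 = y). rewrite <- (add0x 1). rewrite (@iter_S ((mK M T0 T0) @ y) x 0). apply ap_K. }
  rewrite E0, E1 in HY. exact HY.
Qed.

(** Fixes one object whose existence has been proved, so that operations built from it can be named
    and it counts as a constant in definability proofs. *)
Definition pick A (P : A -> Prop) (H : exists x, P x) : A :=
  proj1_sig (constructive_indefinite_description P H).
Lemma pickP A (P : A -> Prop) (H : exists x, P x) : P (pick H).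
Proof. exact (proj2_sig (constructive_indefinite_description P H)). Qed.

Definition monus (x y : N) : N := (pick ex_monus) @ x @ y.

Lemma monus_eq0 x y : monus x y = 0 <-> x <= y.
Proof.
  destruct (pickP ex_monus x y) as [[H1 H2] | H]; change (pick ex_monus @ x @ y) with (monus x y) in *.
  - split; [left; exact H1 | intros _; exact H2].
  - rewrite <- H at 2. split; [intros ->; rewrite addx0; apply le_refl |].
    intros H'. apply (@add_cancel_l _ _ y). rewrite addx0.
    apply le_antisym; [exact H' | apply le_addr].
Qed.

Lemma monusK x y : y <= x -> y + monus x y = x.
Proof.
  intros H. destruct (pickP ex_monus x y) as [[H1 _] | H1]; [destruct (lt_not_le H1 H) | exact H1].
Qed.

Lemma monus_addl x y : monus (x + y) x = y.
Proof. apply (@add_cancel_l _ _ x), monusK, le_addr. Qed.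

Definition neg (x : N) : N := monus 1 x.
Lemma neg0 : neg 0 = 1.
Proof. unfold neg. rewrite <- (add0x 1) at 1. apply monus_addl. Qed.
Lemma neg_eq0 x : neg x = 0 <-> x <> 0.
Proof. unfold neg. rewrite monus_eq0, <- pos_neq0, lt_leS, add0x. reflexivity. Qed.
Definition sg (x : N) : N := neg (neg x).
Lemma sg0 : sg 0 = 0.
Proof. apply neg_eq0. rewrite neg0. apply neq10. Qed.
Lemma sg_pos x : x <> 0 -> sg x = 1.
Proof. intros H. apply neg_eq0 in H. unfold sg. rewrite H. apply neg0. Qed.
Lemma sg_eq0 x : sg x = 0 <-> x = 0.
Proof.
  split; [| intros ->; apply sg0]. intros H. apply NNPP. intros Hx.
  rewrite (sg_pos Hx) in H. exact (neq10 H).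
Qed.
Lemma le1_cases x : x <= 1 -> x = 0 \/ x = 1.
Proof.
  rewrite <- lt_S_le. intros H. destruct (pos_or_0 x) as [| Hx]; [auto | right].
  apply le_antisym; [apply lt_S_le, H | apply le1_pos, Hx].
Qed.
Lemma sg_le1 x : sg x <= 1.
Proof.
  destruct (classic (x = 0)) as [-> | H]; [rewrite sg0; apply lt_le, lt01 |].
  rewrite (sg_pos H). apply le_refl.
Qed.
Lemma sg_id x : x <= 1 -> sg x = x.
Proof. intros [-> | ->]%le1_cases; [apply sg0 | apply sg_pos, neq10]. Qed.

Definition cond (x a b : N) : N := neg x * a + sg x * b.
Lemma cond_eq0 x a b : x = 0 -> cond x a b = a.
Proof. intros ->. unfold cond. rewrite neg0, sg0. ring. Qed.
Lemma cond_neq0 x a b : x <> 0 -> cond x a b = b.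
Proof. intros H. unfold cond. rewrite (sg_pos H), (proj2 (neg_eq0 x) H). ring. Qed.

Lemma definable_monus G (x y : env D G -> N) :
  definable x -> definable y -> definable (fun r => monus (x r) (y r)).
Proof. intros Hx Hy. repeat apply definable_ap; auto using definable_const. Qed.
Lemma definable_neg G (x : env D G -> N) : definable x -> definable (fun r => neg (x r)).
Proof. intros Hx. apply definable_monus; auto using definable_const. Qed.
Lemma definable_sg G (x : env D G -> N) : definable x -> definable (fun r => sg (x r)).
Proof. intros Hx. apply definable_neg, definable_neg, Hx. Qed.
Lemma definable_cond G (x a b : env D G -> N) :
  definable x -> definable a -> definable b -> definable (fun r => cond (x r) (a r) (b r)).
Proof.
  intros. apply definable_add; apply definable_mul; auto using definable_neg, definable_sg.
Qed.

Ltac definable_op := fail.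
Ltac definability :=
  lazymatch goal with
  | |- definable (fun _ => ?c) => apply definable_const
  | |- definable (fun r => _ @ _) => apply definable_ap; definability
  | |- definable (fun r => _ + _) => apply definable_add; definability
  | |- definable (fun r => _ * _) => apply definable_mul; definability
  | |- definable (fun r => iter _ _ _) => apply definable_iter; definability
  | |- definable (fun r => monus _ _) => apply definable_monus; definability
  | |- definable (fun r => neg _) => apply definable_neg; definability
  | |- definable (fun r => sg _) => apply definable_sg; definability
  | |- definable (fun r => cond _ _ _) => apply definable_cond; definability
  | |- _ => first
      [ assumption
      | exact (definable_lookup VZ)
      | exact (definable_lookup (VS VZ))
      | exact (definable_lookup (VS (VS VZ)))
      | exact (definable_lookup (VS (VS (VS VZ))))
      | definable_op; definability ]
  end.

(** The semantic counterpart of a quantifier-free formula with parameters; the value 0 stands for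
    truth. *)
Definition decidable G (P : env D G -> Prop) : Prop :=
  exists c : env D G -> N, definable c /\ forall r, P r <-> c r = 0.

Lemma decidable_iff G (P Q : env D G -> Prop) :
  (forall r, Q r <-> P r) -> decidable P -> decidable Q.
Proof. intros H [c [Hc HP]]. exists c. split; [exact Hc |]. intros r. rewrite H. apply HP. Qed.

Lemma decidable_le G (x y : env D G -> N) :
  definable x -> definable y -> decidable (fun r => x r <= y r).
Proof.
  intros Hx Hy. exists (fun r => monus (x r) (y r)). split; [definability |].
  intros r. rewrite monus_eq0. reflexivity.
Qed.

Lemma decidable_and G (P Q : env D G -> Prop) :
  decidable P -> decidable Q -> decidable (fun r => P r /\ Q r).
Proof.
  intros [c [Hc HP]] [d [Hd HQ]]. exists (fun r => c r + d r). split; [definability |].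
  intros r. rewrite add_eq0, HP, HQ. reflexivity.
Qed.

Lemma decidable_or G (P Q : env D G -> Prop) :
  decidable P -> decidable Q -> decidable (fun r => P r \/ Q r).
Proof.
  intros [c [Hc HP]] [d [Hd HQ]]. exists (fun r => c r * d r). split; [definability |].
  intros r. rewrite mul_eq0, HP, HQ. reflexivity.
Qed.

Lemma decidable_not G (P : env D G -> Prop) : decidable P -> decidable (fun r => ~ P r).
Proof.
  intros [c [Hc HP]]. exists (fun r => neg (c r)). split; [definability |].
  intros r. rewrite neg_eq0, HP. reflexivity.
Qed.

Lemma decidable_imp G (P Q : env D G -> Prop) :
  decidable P -> decidable Q -> decidable (fun r => P r -> Q r).
Proof.
  intros HP HQ. refine (decidable_iff _ (decidable_or (decidable_not HP) HQ)).
  intros r. cbn. tauto.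
Qed.

Lemma decidable_eq G (x y : env D G -> N) :
  definable x -> definable y -> decidable (fun r => x r = y r).
Proof.
  intros Hx Hy.
  refine (decidable_iff _ (decidable_and (decidable_le Hx Hy) (decidable_le Hy Hx))).
  intros r. cbn. split; [intros ->; split; apply le_refl | intros [H H']; exact (le_antisym H H')].
Qed.

Lemma decidable_lt G (x y : env D G -> N) :
  definable x -> definable y -> decidable (fun r => x r < y r).
Proof.
  intros Hx Hy. apply decidable_iff with (fun r => x r + 1 <= y r).
  - intros r. apply lt_leS.
  - apply decidable_le; definability.
Qed.

Ltac decidability :=
  lazymatch goal with
  | |- decidable (fun r => _ /\ _) => apply decidable_and; decidability
  | |- decidable (fun r => _ \/ _) => apply decidable_or; decidability
  | |- decidable (fun r => _ <= _) => apply decidable_le; definability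
  | |- decidable (fun r => _ < _) => apply decidable_lt; definability
  | |- decidable (fun r => _ = _) => apply decidable_eq; definability
  | |- decidable (fun r => ~ _) => apply decidable_not; decidability
  | |- decidable (fun r => _ -> _) => apply decidable_imp; decidability
  | |- _ => assumption
  end.

(** A decidable property has the form [f @ n = 0], so the single induction formula with the function
    [f] as a parameter covers all of them. *)
Lemma ind (P : N -> Prop) : @decidable [T0] (fun r => P (fst r)) ->
  P 0 -> (forall n, P n -> P (n + 1)) -> forall n, P n.
Proof.
  intros [c [[f Hf] HP]] H0 HS n.
  assert (E : forall k, P k <-> f @ k = 0).
  { intros k. rewrite (HP (k, tt) : P k <-> _), <- Hf. reflexivity. }
  assert (HA : @qf [T0; T1] (v1 · v0 ≐ Zero)%ho) by exact I.
  pose proof (@M_basic [T1] _ (@ax_qf_ind [T1] _ HA) (f, tt)) as H. cbn in H.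
  apply E, H; [apply E, H0 |]. intros k Hk. apply E, HS, E, Hk.
Qed.

Definition choice_at (s : ty) : Prop := forall F : D (s ⟶ T0 ⟶ T0),
  (forall x, exists n, F @ x @ n = 0) -> exists Y : D (s ⟶ T0), forall x, F @ x @ (Y @ x) = 0.

Lemma choice_of_sat s :
  (forall G (A : formula G), QF_AC s T0 A -> forall rho, @sat M G A rho) -> choice_at s.
Proof.
  intros HAC F HF.
  assert (HA : @qf [T0; s; s ⟶ T0 ⟶ T0] (v2 · v1 · v0 ≐ Zero)%ho) by exact I.
  pose proof (HAC [s ⟶ T0 ⟶ T0] _ (@qf_ac s T0 _ _ HA) (F, tt)) as H. cbn in H. auto.
Qed.

Lemma choice_1 : choice_at T1.
Proof. apply choice_of_sat. intros G A HA. apply M_RCA. right. exact HA. Qed.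

(** A number is presented to the choice functional of type 2 as a constant function and read back as
    its value at 0. *)
Lemma choice_0 : choice_at T0.
Proof.
  intros F HF.
  destruct (@definable_fun2 T1 T0 T0 (fun f n => F @ (f @ 0) @ n)) as [F' HF']; [definability |].
  destruct (choice_1 (F := F')) as [Y HY].
  { intros f. destruct (HF (f @ 0)) as [n Hn]. exists n. rewrite HF'. exact Hn. }
  destruct (@definable_fun1 T0 T0 (fun x => Y @ ((mK M T0 T0) @ x))) as [Y' HY']; [definability |].
  exists Y'. intros x. specialize (HY ((mK M T0 T0) @ x)).
  rewrite HF', ap_K, <- HY' in HY. exact HY.
Qed.

Lemma choice s (R : D s -> N -> Prop) : choice_at s ->
  @decidable [T0; s] (fun r => R (fst (snd r)) (fst r)) ->
  (forall x, exists n, R x n) -> exists Y : D (s ⟶ T0), forall x, R x (Y @ x).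
Proof.
  intros HAC [c [[F HF] HR]] H.
  assert (E : forall x n, R x n <-> F @ x @ n = 0).
  { intros x n. rewrite (HR (n, (x, tt)) : R x n <-> _), <- HF. reflexivity. }
  destruct (HAC F) as [Y HY].
  - intros x. destruct (H x) as [n Hn]. exists n. apply E, Hn.
  - exists Y. intros x. apply E, HY.
Qed.

(** ** Bounded minimization *)

Lemma ex_mu_step : exists F : D (T1 ⟶ T1), forall g x, F @ g @ x = x + sg (g @ x).
Proof. apply definable_fun2; definability. Qed.

(** A counter that starts at 0 and advances as long as [g] is nonzero: after [n] steps it rests at
    the least zero below [n], or has reached [n]. *)
Definition mu (g : D T1) (n : N) : N := iter ((pick ex_mu_step) @ g) 0 n.

Lemma definable_mu G (g : env D G -> D T1) (n : env D G -> N) :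
  definable g -> definable n -> definable (fun r => mu (g r) (n r)).
Proof. intros Hg Hn. unfold mu. definability. Qed.
Ltac definable_op ::= apply definable_mu.

Lemma mu_0 g : mu g 0 = 0.
Proof. apply iter_0. Qed.
Lemma mu_S g n : mu g (n + 1) = mu g n + sg (g @ (mu g n)).
Proof. unfold mu. rewrite iter_S. apply (pickP ex_mu_step). Qed.

Lemma mu_before g n i : i < mu g n -> g @ i <> 0.
Proof.
  revert n. refine (ind _ _ _); [decidability | |].
  - rewrite mu_0. intros H. destruct (not_lt0 H).
  - intros n IH. rewrite mu_S. destruct (classic (g @ (mu g n) = 0)) as [E | E].
    + rewrite E, sg0, addx0. exact IH.
    + rewrite (sg_pos E). intros [H | ->]%lt_S_cases; auto.
Qed.

Lemma mu_zero g n : mu g n = n \/ g @ (mu g n) = 0.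
Proof.
  revert n. refine (ind _ _ _); [decidability | |].
  - left. apply mu_0.
  - intros n [IH | IH]; rewrite mu_S.
    + destruct (classic (g @ (mu g n) = 0)) as [E | E].
      * rewrite E, sg0, addx0. auto.
      * rewrite (sg_pos E), IH. auto.
    + rewrite IH, sg0, addx0. auto.
Qed.

Lemma mu_spec g n i : i < n -> g @ i = 0 -> mu g n <= i /\ g @ (mu g n) = 0.
Proof.
  intros Hi Hg.
  assert (H : mu g n <= i) by (apply not_lt; intros H; exact (mu_before H Hg)).
  split; [exact H |]. destruct (mu_zero g n) as [E | E]; [| exact E].
  rewrite E in H. destruct (lt_not_le Hi H).
Qed.

Lemma decidable_bex G (n : env D G -> N) (P : N -> env D G -> Prop) :
  definable n -> @decidable (T0 :: G) (fun r => P (fst r) (snd r)) ->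
  decidable (fun r => exists i, i < n r /\ P i r).
Proof.
  intros Hn [c [[x Hx] HP]].
  set (g := fun r : env D G => ap_env (t := T1) x r).
  assert (Hg : definable g) by (exists x; reflexivity).
  assert (E : forall i r, P i r <-> (g r) @ i = 0).
  { intros i r. rewrite (HP (i, r) : P i r <-> _), <- Hx. reflexivity. }
  apply decidable_iff with (fun r => mu (g r) (n r) < n r /\ (g r) @ (mu (g r) (n r)) = 0);
    [| decidability].
  intros r. split.
  - intros (i & Hi & HPi). apply E in HPi. destruct (mu_spec Hi HPi) as [H1 H2].
    split; [exact (le_lt_tr H1 Hi) | exact H2].
  - intros [H1 H2]. exists (mu (g r) (n r)). split; [exact H1 | apply E, H2].
Qed.

Lemma decidable_ball G (n : env D G -> N) (P : N -> env D G -> Prop) :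
  definable n -> @decidable (T0 :: G) (fun r => P (fst r) (snd r)) ->
  decidable (fun r => forall i, i < n r -> P i r).
Proof.
  intros Hn HP. refine (decidable_iff _ (decidable_not (decidable_bex (P := fun i r => ~ P i r) Hn (decidable_not HP)))).
  intros r. cbn. split.
  - intros H (i & Hi & HN). exact (HN (H i Hi)).
  - intros H i Hi. apply NNPP. intros HN. apply H. eauto.
Qed.

Lemma least (P : N -> Prop) : @decidable [T0] (fun r => P (fst r)) ->
  (exists n, P n) -> exists n, P n /\ forall i, i < n -> ~ P i.
Proof.
  intros [c [[g Hg] HP]] [n Hn].
  assert (E : forall k, P k <-> g @ k = 0).
  { intros k. rewrite (HP (k, tt) : P k <-> _), <- Hg. reflexivity. }
  exists (mu g (n + 1)). split.
  - apply E, (mu_spec (lt_S n)), E, Hn.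
  - intros i Hi HPi. apply E in HPi. exact (mu_before Hi HPi).
Qed.

(** ** Pairing and finite sequences *)

Definition pair_ (x y : N) : N := (x + y) * (x + y) + y.

Lemma ex_sqrt_test : exists F : D (T0 ⟶ T1), forall z s, F @ z @ s = monus (z + 1) ((s + 1) * (s + 1)).
Proof. apply definable_fun2; definability. Qed.

(** The integer square root. It recovers [x + y] from [pair_ x y], because adding [y] to the square
    of [x + y] stays below the next square. *)
Definition root (z : N) : N := mu ((pick ex_sqrt_test) @ z) (z + 1).

Lemma le_sqr x : x <= x * x.
Proof.
  destruct (pos_or_0 x) as [-> | H]; [apply le0x |].
  rewrite <- (mulx1 x) at 1. apply le_mul; [apply le_refl | apply le1_pos, H].
Qed.

Lemma root_spec z : root z * root z <= z /\ z < (root z + 1) * (root z + 1).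
Proof.
  assert (E : forall s, (pick ex_sqrt_test) @ z @ s = 0 <-> z < (s + 1) * (s + 1)).
  { intros s. rewrite (pickP ex_sqrt_test), monus_eq0, lt_leS. reflexivity. }
  assert (Hz : (pick ex_sqrt_test) @ z @ z = 0).
  { apply E, lt_leS. apply le_sqr. }
  destruct (mu_spec (lt_S z) Hz) as [_ H]. split; [| apply E, H].
  destruct (pos_or_0 (root z)) as [H0 | Hp].
  - rewrite H0, mulx0. apply le0x.
  - apply lt_leS in Hp. destruct (le_ex_diff Hp) as [d Hd].
    apply not_lt. intros Hlt. apply (@mu_before ((pick ex_sqrt_test) @ z) (z + 1) d).
    + change (d < root z). rewrite <- Hd. replace (0 + 1 + d) with (d + 1) by ring. apply lt_S.
    + apply E. replace (d + 1) with (root z); [exact Hlt |]. rewrite <- Hd. ring.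
Qed.

Lemma root_unique z s : s * s <= z -> z < (s + 1) * (s + 1) -> root z = s.
Proof.
  assert (W : forall a b, a * a <= z -> z < (b + 1) * (b + 1) -> a <= b).
  { intros a b Ha Hb. apply not_lt. intros H. apply lt_leS in H.
    apply (lt_not_le Hb). apply le_tr with (a * a); [apply le_mul |]; assumption. }
  intros H1 H2. destruct (root_spec z) as [H3 H4]. apply le_antisym; apply W; assumption.
Qed.

Definition second (z : N) : N := monus z (root z * root z).
Definition first (z : N) : N := monus (root z) (second z).

Lemma root_pair x y : root (pair_ x y) = x + y.
Proof.
  apply root_unique; unfold pair_; [apply le_addr |].
  apply lt_leS. replace ((x + y + 1) * (x + y + 1)) with ((x + y) * (x + y) + y + 1 + (x + x + y)) by ring.
  apply le_addr.
Qed.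
Lemma second_pair x y : second (pair_ x y) = y.
Proof. unfold second. rewrite root_pair. apply monus_addl. Qed.
Lemma first_pair x y : first (pair_ x y) = x.
Proof. unfold first. rewrite second_pair, root_pair, addC. apply monus_addl. Qed.

Lemma definable_root G (x : env D G -> N) : definable x -> definable (fun r => root (x r)).
Proof. intros Hx. unfold root. definability. Qed.
Lemma definable_second G (x : env D G -> N) : definable x -> definable (fun r => second (x r)).
Proof. intros Hx. unfold second. definability; apply definable_root, Hx. Qed.
Lemma definable_first G (x : env D G -> N) : definable x -> definable (fun r => first (x r)).
Proof.
  intros Hx. apply definable_monus; [apply definable_root, Hx | apply definable_second, Hx].
Qed.
Lemma definable_pair G (x y : env D G -> N) :
  definable x -> definable y -> definable (fun r => pair_ (x r) (y r)).
Proof. intros Hx Hy. unfold pair_. definability. Qed.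
Ltac definable_op ::=
  first [apply definable_mu | apply definable_first | apply definable_second | apply definable_pair].

Lemma ex_rec_step : exists F : D ((T0 ⟶ T0 ⟶ T0) ⟶ T1), forall h p,
  F @ h @ p = pair_ (first p + 1) (h @ (first p) @ (second p)).
Proof. apply definable_fun2; definability. Qed.

(** The recursor only iterates a function, so the step number is carried along as the first
    component of a pair. *)
Definition primrec (h : D (T0 ⟶ T0 ⟶ T0)) (m n : N) : N :=
  second (iter ((pick ex_rec_step) @ h) (pair_ 0 m) n).

Lemma definable_primrec G (h : env D G -> D (T0 ⟶ T0 ⟶ T0)) (m n : env D G -> N) :
  definable h -> definable m -> definable n ->
  definable (fun r => primrec (h r) (m r) (n r)).
Proof. intros Hh Hm Hn. unfold primrec. definability. Qed.

Lemma primrec_0 h m : primrec h m 0 = m.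
Proof. unfold primrec. rewrite iter_0. apply second_pair. Qed.

Lemma primrec_S h m n : primrec h m (n + 1) = h @ n @ (primrec h m n).
Proof.
  unfold primrec. rewrite iter_S, (pickP ex_rec_step), second_pair. f_equal. f_equal.
  revert n. refine (ind _ _ _); [decidability | |].
  - rewrite iter_0. apply first_pair.
  - intros n IH. rewrite iter_S, (pickP ex_rec_step), first_pair, IH. reflexivity.
Qed.

Definition snoc_ (s a : N) : N := pair_ s a + 1.
Definition parent (c : N) : N := first (monus c 1).
Definition last_ (c : N) : N := second (monus c 1).

Lemma parent_snoc s a : parent (snoc_ s a) = s.
Proof. unfold parent, snoc_. rewrite addC, monus_addl. apply first_pair. Qed.
Lemma last_snoc s a : last_ (snoc_ s a) = a.
Proof. unfold last_, snoc_. rewrite addC, monus_addl. apply second_pair. Qed.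
Lemma lt_snoc s a : s < snoc_ s a.
Proof.
  unfold snoc_. apply lt_S_le. unfold pair_.
  apply le_tr with (s + a); [apply le_addr |].
  apply le_tr with ((s + a) * (s + a)); [apply le_sqr | apply le_addr].
Qed.
Lemma le_snoc s a s' a' : s <= s' -> a <= a' -> snoc_ s a <= snoc_ s' a'.
Proof.
  intros Hs Ha. unfold snoc_, pair_. auto 6 using le_add, le_mul, le_refl.
Qed.

Lemma ex_bar_step : exists F : D (T1 ⟶ T0 ⟶ T0 ⟶ T0), forall f i s, F @ f @ i @ s = snoc_ s (f @ i).
Proof. apply definable_fun3. unfold snoc_. definability. Qed.

Definition bar (f : D T1) (n : N) : N := primrec ((pick ex_bar_step) @ f) 0 n.

Lemma definable_bar G (f : env D G -> D T1) (n : env D G -> N) :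
  definable f -> definable n -> definable (fun r => bar (f r) (n r)).
Proof. intros Hf Hn. apply definable_primrec; definability. Qed.

Lemma bar_0 f : bar f 0 = 0.
Proof. apply primrec_0. Qed.
Lemma bar_S f n : bar f (n + 1) = snoc_ (bar f n) (f @ n).
Proof. unfold bar. rewrite primrec_S. apply (pickP ex_bar_step). Qed.

Lemma ex_parent : exists f : D T1, forall c, f @ c = parent c.
Proof. apply definable_fun1. unfold parent. definability. Qed.

(** Codes are built by appending, so they are read from the end: entry [i] of a sequence of length
    [n] is the last entry of the code [n - (i + 1)] steps up. *)
Definition ancestor (c j : N) : N := iter (pick ex_parent) c j.
Lemma ancestor_0 c : ancestor c 0 = c.
Proof. apply iter_0. Qed.
Lemma ancestor_S c j : ancestor c (j + 1) = parent (ancestor c j).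
Proof. unfold ancestor. rewrite iter_S. apply (pickP ex_parent). Qed.

Lemma definable_ancestor G (c j : env D G -> N) :
  definable c -> definable j -> definable (fun r => ancestor (c r) (j r)).
Proof. intros Hf Hn. unfold ancestor. definability. Qed.

Ltac definable_op ::=
  first [ apply definable_mu | apply definable_first | apply definable_second
        | apply definable_pair | apply definable_bar | apply definable_ancestor ].

(** The sequence of length [n] coded by [c], continued with zeros. *)
Lemma ex_decode : exists F : D (T0 ⟶ T0 ⟶ T1), forall n c i,
  F @ n @ c @ i = cond (monus (i + 1) n) (last_ (ancestor c (monus n (i + 1)))) 0.
Proof. apply definable_fun3. unfold last_. definability. Qed.

Definition decode (n c : N) : D T1 := (pick ex_decode) @ n @ c.

Lemma decode_in n c i : i < n -> (decode n c) @ i = last_ (ancestor c (monus n (i + 1))).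
Proof.
  intros H. unfold decode. rewrite (pickP ex_decode). apply cond_eq0.
  apply monus_eq0, lt_leS, H.
Qed.

Lemma decode_out n c i : n <= i -> (decode n c) @ i = 0.
Proof.
  intros H. unfold decode. rewrite (pickP ex_decode). apply cond_neq0.
  rewrite monus_eq0, <- lt_leS. intros H'. exact (lt_not_le H' H).
Qed.

Lemma ancestor_bar f n j : j <= n -> ancestor (bar f n) j = bar f (monus n j).
Proof.
  revert j. refine (ind _ _ _); [decidability | |].
  - intros _. rewrite ancestor_0. f_equal. symmetry.
    rewrite <- (add0x n) at 1. apply monus_addl.
  - intros j IH H. apply lt_leS in H. rewrite ancestor_S, IH by (left; exact H).
    destruct (le_ex_diff (proj1 (lt_leS j n) H)) as [d <-]. rewrite monus_addl.
    replace (j + 1 + d) with (j + (d + 1)) by ring.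
    rewrite monus_addl, bar_S. apply parent_snoc.
Qed.

Lemma decode_bar f n i : i < n -> (decode n (bar f n)) @ i = f @ i.
Proof.
  intros H. apply lt_leS in H.
  rewrite decode_in by (apply lt_leS; exact H).
  destruct (le_ex_diff H) as [d <-]. rewrite monus_addl, ancestor_bar by apply le_addl.
  replace (monus _ d) with (i + 1); [rewrite bar_S; apply last_snoc |].
  rewrite (addC _ d), monus_addl. reflexivity.
Qed.

Lemma bar_S_eq f g n : bar f (n + 1) = bar g (n + 1) <-> bar f n = bar g n /\ f @ n = g @ n.
Proof.
  rewrite !bar_S. split.
  - intros H. split; [apply (f_equal parent) in H | apply (f_equal last_) in H];
      rewrite ?parent_snoc, ?last_snoc in H; exact H.
  - intros [-> ->]. reflexivity.
Qed.

Lemma bar_eq f g n : bar f n = bar g n <-> forall i, i < n -> f @ i = g @ i.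
Proof.
  split.
  - intros H i Hi. rewrite <- (decode_bar f Hi), <- (decode_bar g Hi), H. reflexivity.
  - intros H. assert (W : forall j, j <= n -> bar f j = bar g j).
    { refine (ind _ _ _); [decidability | intros _; rewrite !bar_0; reflexivity |].
      intros j IH Hj. apply lt_leS in Hj. apply bar_S_eq.
      split; [apply IH; left; exact Hj | apply H, Hj]. }
    apply W, le_refl.
Qed.

Lemma bar_eq_le f g m n : m <= n -> bar f n = bar g n -> bar f m = bar g m.
Proof. rewrite !bar_eq. intros Hm H i Hi. exact (H i (lt_le_tr Hi Hm)). Qed.

Lemma le_bar f n : n <= bar f n.
Proof.
  revert n. refine (ind _ _ _); [decidability | apply le0x |].
  intros n IH. rewrite bar_S. apply lt_leS, (le_lt_tr IH), lt_snoc.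
Qed.

Lemma bar_decode_bar f n m : m <= n -> bar (decode n (bar f n)) m = bar f m.
Proof.
  intros Hm. apply bar_eq. intros i Hi. apply decode_bar, (lt_le_tr Hi Hm).
Qed.

Lemma decidable_fun s (P : D s -> Prop) : @decidable [s] (fun r => P (fst r)) ->
  exists f : D (s ⟶ T0), forall x, P x <-> f @ x = 0.
Proof.
  intros [c [[f Hf] HP]]. exists f. intros x.
  rewrite (HP (x, tt) : P x <-> _), <- Hf. reflexivity.
Qed.

Lemma decidable_char s (P : D s -> Prop) : @decidable [s] (fun r => P (fst r)) ->
  exists f : D (s ⟶ T0), forall x, f @ x <= 1 /\ (P x <-> f @ x = 1).
Proof.
  intros HP. destruct (decidable_fun (P := fun x => ~ P x) (decidable_not HP)) as [g Hg].
  destruct (@definable_fun1 s T0 (fun x => sg (g @ x))) as [f Hf]; [definability |].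
  exists f. intros x. rewrite Hf. split; [apply sg_le1 |]. specialize (Hg x). cbn in Hg. split.
  - intros H. apply sg_pos. tauto.
  - intros H. apply NNPP. intros HN. apply Hg in HN. rewrite HN, sg0 in H. exact (neq10 (eq_sym H)).
Qed.

(** ** The principles *)

Definition inC (f : D T1) : Prop := forall i, f @ i <= 1.
Definition modulus (Y : D T2) (m : N) : Prop :=
  forall f g, inC f -> inC g -> bar f m = bar g m -> Y @ f = Y @ g.
Definition cont (Y : D T2) : Prop :=
  forall f, exists n, forall g, bar f n = bar g n -> Y @ f = Y @ g.

Definition has_exists2 : Prop :=
  exists phi : D T2, forall f, (exists n, f @ n = 0) <-> phi @ f = 0.
Definition has_exists3 : Prop :=
  exists E : D T3, forall Y, (exists f, Y @ f = 0) <-> E @ Y = 0.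
Definition has_kappa : Prop :=
  exists kappa : D T3, forall Y, kappa @ Y = 0 <-> exists f, inC f /\ 0 < Y @ f.
Definition has_MUC : Prop := exists Omega : D T3, forall Y, modulus Y (Omega @ Y).
Definition has_FF : Prop := exists Phi : D T3, forall Y, cont Y -> modulus Y (Phi @ Y).

Definition binary_tree (T : D T1) : Prop :=
  (forall n, T @ n <= 1) /\
  forall n, T @ n = 1 -> n = 0 \/ exists s a, a <= 1 /\ n = snoc_ s a /\ T @ s = 1.
Definition has_WKL : Prop := forall T, binary_tree T ->
  (forall n, exists v, n < v /\ T @ v = 1) -> exists f, inC f /\ forall n, T @ (bar f n) = 1.

(** A quantifier over numbers becomes one over functions [g] by using only the value [g @ 0]. *)
Lemma exists3_exists2 : has_exists3 -> has_exists2.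
Proof.
  intros [E HE].
  destruct (@definable_fun2 T1 T1 T0 (fun f g => f @ (g @ 0))) as [W HW]; [definability |].
  destruct (@definable_fun1 T1 T0 (fun f => E @ (W @ f))) as [phi Hphi]; [definability |].
  exists phi. intros f. rewrite Hphi, <- HE. split.
  - intros [n Hn]. exists ((mK M T0 T0) @ n). rewrite HW, ap_K. exact Hn.
  - intros [g Hg]. exists (g @ 0). rewrite <- HW. exact Hg.
Qed.

Lemma ex_truncate : exists F : D (T1 ⟶ T1), forall f i, F @ f @ i = sg (f @ i).
Proof. apply definable_fun2; definability. Qed.

(** A retraction of Baire space onto Cantor space that respects agreement of initial segments;
    through it a quantifier over Cantor space becomes an unrestricted one. *)
Definition truncate (f : D T1) : D T1 := (pick ex_truncate) @ f.

Lemma ap_truncate f i : (truncate f) @ i = sg (f @ i).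
Proof. apply (pickP ex_truncate). Qed.
Lemma truncate_inC f : inC (truncate f).
Proof. intros i. rewrite ap_truncate. apply sg_le1. Qed.
Lemma truncate_id f : inC f -> truncate f = f.
Proof. intros H. apply M_ext. intros i. rewrite ap_truncate. apply sg_id, H. Qed.
Lemma bar_truncate f g n : bar f n = bar g n -> bar (truncate f) n = bar (truncate g) n.
Proof. rewrite !bar_eq. intros H i Hi. rewrite !ap_truncate, H by exact Hi. reflexivity. Qed.

Lemma exists3_kappa : has_exists3 -> has_kappa.
Proof.
  intros [E HE].
  destruct (@definable_fun2 T2 T1 T0 (fun Y f => neg (Y @ ((pick ex_truncate) @ f)))) as [W HW];
    [definability |].
  destruct (@definable_fun1 T2 T0 (fun Y => E @ (W @ Y))) as [kappa Hk]; [definability |].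
  exists kappa. intros Y. rewrite Hk, <- HE. split.
  - intros [f Hf]. exists (truncate f). split; [apply truncate_inC |].
    rewrite HW, neg_eq0 in Hf. apply pos_neq0, Hf.
  - intros (f & HfC & Hf). exists f. rewrite HW, neg_eq0.
    change (pick ex_truncate @ f) with (truncate f). rewrite truncate_id by exact HfC.
    apply pos_neq0, Hf.
Qed.

(** Feferman's search operator. Since [phi] decides whether [f] has a zero, the property required of
    [n] is decidable, and choice for numbers over functions selects [n]. *)
Lemma exists2_mu : has_exists2 ->
  exists m : D T2, forall f, (exists n, f @ n = 0) -> f @ (m @ f) = 0.
Proof.
  intros [phi Hphi].
  destruct (@choice T1 (fun f n => phi @ f = 0 -> f @ n = 0) choice_1) as [m Hm].
  - decidability.
  - intros f. destruct (classic (exists n, f @ n = 0)) as [[n Hn] | HN].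
    + exists n. auto.
    + exists 0. intros H. apply Hphi in H. contradiction.
  - exists m. intros f Hf. apply Hm, Hphi, Hf.
Qed.

(** With [∃²], every element of Baire space is decoded from the graph of a
    function, an element of Cantor space. *)
Lemma kappa_exists3 : has_kappa -> has_exists2 -> has_exists3.
Proof.
  intros [kappa Hk] HE2. destruct (exists2_mu HE2) as [m Hm].
  destruct (@definable_fun3 T1 T0 T0 T0 (fun x i j => neg (x @ (pair_ i j)))) as [row Hrow];
    [definability |].
  destruct (@definable_fun2 T1 T0 T0 (fun x i => m @ (row @ x @ i))) as [fn Hfn]; [definability |].
  destruct (@definable_fun2 T2 T1 T0 (fun Y x => neg (Y @ (fn @ x)))) as [W HW]; [definability |].
  destruct (@definable_fun1 T2 T0 (fun Y => kappa @ (W @ Y))) as [E HE]; [definability |].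
  assert (Hsurj : forall f, exists x, inC x /\ fn @ x = f).
  { intros f.
    destruct (@decidable_char T0 (fun p => f @ (first p) = second p)) as [x Hx]; [decidability |].
    exists x. split; [intros p; apply Hx |]. apply M_ext. intros i. rewrite Hfn.
    assert (Hij : forall j, row @ x @ i @ j = 0 <-> f @ i = j).
    { intros j. rewrite Hrow, neg_eq0. destruct (Hx (pair_ i j)) as [H1 H2].
      rewrite first_pair, second_pair in H2. rewrite H2.
      apply le1_cases in H1. pose proof neq10. split; [tauto | congruence]. }
    symmetry. apply Hij, Hm. exists (f @ i). apply Hij. reflexivity. }
  exists E. intros Y. rewrite HE, Hk. split.
  - intros [f Hf]. destruct (Hsurj f) as (x & Hx & <-). exists x. split; [exact Hx |].
    rewrite HW, Hf, neg0. apply lt01.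
  - intros (x & _ & Hx). exists (fn @ x). rewrite HW, pos_neq0, neg_eq0 in Hx.
    apply NNPP, Hx.
Qed.

(** * Search through Cantor space, boundedness and binary trees *)

Definition ones : D T1 := (mK M T0 T0) @ 1.

Lemma bar_mono f g n : (forall i, f @ i <= g @ i) -> bar f n <= bar g n.
Proof.
  intros H. revert n. refine (ind _ _ _); [decidability | rewrite !bar_0; apply le_refl |].
  intros n IH. rewrite !bar_S. apply le_snoc; auto.
Qed.

(** Codes are monotone in the entries. With this bound, a search through Cantor space up to a fixed
    length is a bounded search over numbers. *)
Lemma bar_le_ones f n : inC f -> bar f n <= bar ones n.
Proof. intros H. apply bar_mono. intros i. unfold ones. rewrite ap_K. apply H. Qed.

Lemma bar_le_len f m n : m <= n -> bar f m <= bar f n.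
Proof.
  intros H. destruct (le_ex_diff H) as [d <-]. clear H.
  revert d. refine (ind _ _ _); [decidability | rewrite addx0; apply le_refl |].
  intros d IH. rewrite <- addA, bar_S. apply lt_le, (le_lt_tr IH), lt_snoc.
Qed.

(** The truncation makes every number [c] name an element of Cantor space, even if it codes no
    binary sequence of length [n]; a search may thus run over all [c] below a bound. *)
Definition point (n c : N) : D T1 := truncate (decode n c).

Lemma point_inC n c : inC (point n c).
Proof. apply truncate_inC. Qed.

Lemma bar_point f n m : inC f -> m <= n -> bar (point n (bar f n)) m = bar f m.
Proof.
  intros Hf Hm. unfold point. rewrite <- (truncate_id Hf) at 2.
  apply bar_truncate, bar_decode_bar, Hm.
Qed.

Lemma modulus_point Y n f : modulus Y n -> inC f -> Y @ (point n (bar f n)) = Y @ f.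
Proof. intros HY Hf. apply HY; auto using point_inC, bar_point, le_refl. Qed.

Lemma definable_point G (n c : env D G -> N) :
  definable n -> definable c -> definable (fun r => point (n r) (c r)).
Proof. intros Hn Hc. unfold point, truncate, decode. definability. Qed.

Ltac definable_op ::=
  first [ apply definable_mu | apply definable_first | apply definable_second
        | apply definable_pair | apply definable_bar | apply definable_ancestor
        | apply definable_point | apply definable_primrec ].

Lemma MUC_kappa : has_MUC -> has_kappa.
Proof.
  intros [Omega HO].
  destruct (@decidable_fun T2 (fun Y => exists c,
    c < bar ones (Omega @ Y) + 1 /\ 0 < Y @ (point (Omega @ Y) c))) as [kappa Hk].
  { apply (@decidable_bex [T2] (fun r => bar ones (Omega @ (fst r)) + 1)
      (fun c r => 0 < (fst r) @ (point (Omega @ (fst r)) c))); [definability | decidability]. }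
  exists kappa. intros Y. rewrite <- Hk. split.
  - intros (c & _ & Hc). exists (point (Omega @ Y) c). split; [apply point_inC | exact Hc].
  - intros (f & HfC & Hf). exists (bar f (Omega @ Y)). split.
    + apply lt_S_le, bar_le_ones, HfC.
    + rewrite modulus_point by auto. exact Hf.
Qed.

Lemma MUC_FF : has_MUC -> has_FF.
Proof. intros [Omega HO]. exists Omega. intros Y _. apply HO. Qed.

(** The sum of the values below [k], computed by primitive recursion, dominates each of them. *)
Lemma ex_upper_bound (Z : D T1) k : exists b, forall c, c < k -> Z @ c <= b.
Proof.
  destruct (@definable_fun2 T0 T0 T0 (fun c s => s + Z @ c)) as [h Hh]; [definability |].
  exists (primrec h 0 k). intros c. revert k. refine (ind _ _ _); [decidability | |].
  - intros H. destruct (not_lt0 H).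
  - intros k IH. rewrite primrec_S, Hh. intros [H | ->]%lt_S_cases.
    + apply (le_tr (IH H)), le_addr.
    + apply le_addl.
Qed.

Lemma modulus_bounded Y m : modulus Y m -> exists b, forall f, inC f -> Y @ f <= b.
Proof.
  intros HY. destruct (@definable_fun1 T0 T0 (fun c => Y @ (point m c))) as [Z HZ]; [definability |].
  destruct (ex_upper_bound Z (bar ones m + 1)) as [b Hb]. exists b. intros f Hf.
  rewrite <- (modulus_point HY Hf), <- HZ. apply Hb, lt_S_le, bar_le_ones, Hf.
Qed.

Lemma parent_0 : parent 0 = 0.
Proof.
  unfold parent. replace (monus 0 1) with (pair_ 0 0); [apply first_pair |].
  replace (monus 0 1) with 0 by (symmetry; apply monus_eq0, le0x).
  unfold pair_. ring.
Qed.

Lemma tree_bar T f n d : binary_tree T -> T @ (bar f (n + d)) = 1 -> T @ (bar f n) = 1.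
Proof.
  intros [_ HT]. revert d. refine (ind _ _ _); [decidability | rewrite addx0; auto |].
  intros d IH H. apply IH. rewrite <- addA, bar_S in H.
  destruct (HT _ H) as [H0 | (s & a & _ & E & Hs)]; [destruct (S_neq0 H0) |].
  apply (f_equal parent) in E. rewrite !parent_snoc in E. congruence.
Qed.

(** Membership passes to parents, and every nonzero ancestor exceeds its parent, so 0 is reached
    within [v] steps. The least number of steps is the length [l]; the entries removed on the way
    are binary. *)
Lemma tree_decode T v : binary_tree T -> T @ v = 1 -> exists f l, inC f /\ v = bar f l.
Proof.
  intros [_ HT] Hv.
  assert (Hu : forall j, T @ (ancestor v j) = 1).
  { refine (ind _ _ _); [decidability | rewrite ancestor_0; exact Hv |].
    intros j IH. rewrite ancestor_S. pose proof IH as IH'. apply HT in IH'.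
    destruct IH' as [E | (s & a & _ & E & Hs)]; rewrite E in *.
    - rewrite parent_0. exact IH.
    - rewrite parent_snoc. exact Hs. }
  assert (Hdec : forall j, ancestor v j <> 0 -> exists a, a <= 1 /\
    ancestor v j = snoc_ (ancestor v (j + 1)) a).
  { intros j Hj. rewrite ancestor_S.
    destruct (HT _ (Hu j)) as [E | (s & a & Ha & E & _)]; [contradiction |].
    exists a. rewrite E, parent_snoc. auto. }
  assert (Hz : forall j, ancestor v j = 0 \/ ancestor v j + j <= v).
  { refine (ind _ _ _); [decidability | |].
    - right. rewrite ancestor_0, addx0. apply le_refl.
    - intros j IH. destruct (classic (ancestor v j = 0)) as [E | E].
      + left. rewrite ancestor_S, E. apply parent_0.
      + right. destruct IH as [E' | IH]; [contradiction |].
        destruct (Hdec j E) as (a & _ & Ea). rewrite Ea in IH.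
        apply le_tr with (2 := IH). rewrite (addC j), <- addA.
        apply le_add2r, lt_leS, lt_snoc. }
  destruct (@least (fun j => ancestor v j = 0)) as (l & Hl & Hmin); [decidability | |].
  { exists v. destruct (Hz v) as [E | H]; [exact E |]. apply le0.
    apply not_lt. intros Hp. apply (lt_add2r v) in Hp. rewrite add0x in Hp.
    exact (lt_not_le Hp H). }
  (* Entry [i] is found [j = l - (i + 1)] steps up, where the code is still nonzero because [j] is
     below the least [l]. *)
  assert (Hback : forall i, i < l -> exists j a, monus l (i + 1) = j /\ monus l i = j + 1 /\
    a <= 1 /\ ancestor v j = snoc_ (ancestor v (j + 1)) a).
  { intros i Hi. apply lt_leS in Hi. destruct (le_ex_diff Hi) as [j Ej].
    exists j. destruct (Hdec j) as (a & Ha & E).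
    - apply Hmin. rewrite <- Ej. replace (i + 1 + j) with (i + j + 1) by ring.
      apply lt_S_le, le_addl.
    - exists a. repeat split; auto; rewrite <- Ej; [apply monus_addl |].
      rewrite addA, (addC 1). apply monus_addl. }
  exists (decode l v), l. split.
  - intros i. destruct (lt_or_le i l) as [Hi | Hi]; [| rewrite decode_out by exact Hi; apply le0x].
    rewrite decode_in by exact Hi. destruct (Hback i Hi) as (j & a & -> & _ & Ha & ->).
    rewrite last_snoc. exact Ha.
  - assert (W : forall i, i <= l -> bar (decode l v) i = ancestor v (monus l i)).
    { refine (ind _ _ _); [unfold decode; decidability | |].
      - intros _. rewrite bar_0. rewrite <- Hl at 1. f_equal. rewrite <- (add0x l) at 2.
        symmetry; apply monus_addl.
      - intros i IH Hi. apply lt_leS in Hi. rewrite bar_S, IH, decode_in by (try left; exact Hi).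
        destruct (Hback i Hi) as (j & a & -> & -> & _ & ->). rewrite last_snoc. reflexivity. }
    rewrite W by apply le_refl. rewrite <- (addx0 l) at 1. rewrite monus_addl, ancestor_0.
    reflexivity.
Qed.

(** If a tree has no path, then the length at which [f] leaves it is a
    continuous functional, hence bounded on Cantor space. *)
Lemma FF_WKL : has_FF -> has_WKL.
Proof.
  intros [Phi HPhi] T HT Hinf. apply NNPP. intros HN.
  set (R := fun f n => T @ (bar (truncate f) n) <> 1 /\
                       forall i, i < n -> T @ (bar (truncate f) i) = 1).
  destruct (@choice T1 R choice_1) as [Y HY].
  - unfold R, truncate. apply decidable_and; [decidability |].
    apply (@decidable_ball [T0; T1] fst
      (fun i r => T @ (bar ((pick ex_truncate) @ (fst (snd r))) i) = 1));
      [definability | decidability].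
  - intros f. destruct (@least (fun n => T @ (bar (truncate f) n) <> 1)) as (n & Hn & Hmin).
    + decidability.
    + apply NNPP. intros HN'. apply HN. exists (truncate f). split; [apply truncate_inC |].
      intros n. apply NNPP. eauto.
    + exists n. split; [exact Hn |]. intros i Hi. apply NNPP. exact (Hmin i Hi).
  - assert (Hcont : cont Y).
    (* [Y] is its own modulus of continuity: whether the truncation of [f] leaves the tree at length
       [Y @ f] depends only on its values below that length. *)
    { intros f. exists (Y @ f). intros g Hfg. destruct (HY f) as [H1 H2].
      destruct (HY g) as [H3 H4]. apply bar_truncate in Hfg.
      assert (E : forall i, i <= Y @ f -> bar (truncate f) i = bar (truncate g) i)
        by (intros i Hi; exact (bar_eq_le Hi Hfg)).
      apply le_antisym; apply not_lt; intros Hlt.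
      - apply H3. rewrite <- E by (left; exact Hlt). apply H2, Hlt.
      - apply H1. rewrite E by apply le_refl. apply H4, Hlt. }
    destruct (modulus_bounded (HPhi Y Hcont)) as [b Hb].
    (* A node beyond [bar ones b] is longer than [b], whereas a sequence through it has left the
       tree at length at most [b]. *)
    destruct (Hinf (bar ones b)) as (v & Hv & HvT).
    destruct (tree_decode HT HvT) as (f & l & Hf & ->).
    assert (Hbl : b < l).
    { destruct (lt_or_le b l) as [H | H]; [exact H |].
      destruct (lt_not_le Hv). apply (le_tr (bar_le_ones l Hf)), bar_le_len, H. }
    destruct (HY f) as [H1 _]. apply H1. rewrite truncate_id by exact Hf.
    destruct (le_ex_diff (le_tr (Hb f Hf) (lt_le Hbl))) as [d Hd].
    apply (@tree_bar T f _ d HT). rewrite Hd. exact HvT.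
Qed.

(** ** Discontinuous functionals and [∃²] *)

Lemma mu_le g n : mu g n <= n.
Proof.
  revert n. refine (ind _ _ _); [decidability | rewrite mu_0; apply le_refl |].
  intros n IH. rewrite mu_S. apply le_add; [exact IH | apply sg_le1].
Qed.

(** Grilliot's trick: [h] is mapped to the [n]-th term of the sequence if [n]
    is the least zero of [h], and to the limit [f] if [h] has no zero. *)
Lemma grilliot (Y : D T2) (f : D T1) (s : D (T0 ⟶ T1)) :
  (forall n, bar (s @ n) n = bar f n) -> (forall n, Y @ (s @ n) <> Y @ f) -> has_exists2.
Proof.
  intros Hs HY.
  assert (Hsi : forall n i, i < n -> s @ n @ i = f @ i).
  { intros n i Hi. specialize (Hs n). rewrite bar_eq in Hs. apply Hs, Hi. }
  (* At [i] only the values of [h] up to [i] are inspected. If the least zero lies beyond,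
     [mu h (i + 1)] is [i + 1], and [s @ (i + 1)] agrees at [i] with [f] and with all later
     terms. *)
  destruct (@definable_fun2 T1 T0 T0 (fun h i => s @ (mu h (i + 1)) @ i)) as [H HH];
    [definability |].
  destruct (@decidable_fun T1 (fun h => Y @ (H @ h) <> Y @ f)) as [phi Hphi]; [decidability |].
  exists phi. intros h. rewrite <- Hphi. split.
  - intros Hex. destruct (@least (fun n => h @ n = 0)) as (n & Hn & Hmin); [decidability | exact Hex |].
    replace (H @ h) with (s @ n); [apply HY |]. apply M_ext. intros i. rewrite HH.
    destruct (lt_or_le n (i + 1)) as [Hi | Hi].
    + destruct (mu_spec Hi Hn) as [H1 H2]. destruct H1 as [H1 | ->]; [destruct (Hmin _ H1 H2) | reflexivity].
    + assert (E : mu h (i + 1) = i + 1).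
      { destruct (mu_zero h (i + 1)) as [E | E]; [exact E |].
        apply le_antisym; [apply mu_le |]. apply not_lt. intros H1.
        exact (Hmin _ (lt_le_tr H1 Hi) E). }
      rewrite E, !Hsi; [reflexivity | apply lt_S | apply lt_leS, Hi].
  - intros HN. apply NNPP. intros Hno. apply HN. f_equal. apply M_ext. intros i. rewrite HH.
    destruct (mu_zero h (i + 1)) as [E | E]; [| destruct Hno; eauto].
    rewrite E. apply Hsi, lt_S.
Qed.

(** Choice yields only numbers, so the sequence for Grilliot's trick must consist of finitely coded
    functions. If initial segments of some [g], continued with zeros, miss the value [Y @ g]
    arbitrarily far out, they form the sequence. Otherwise any function witnessing discontinuity can
    be replaced by such a continuation with the same value. *)
Lemma discontinuous_exists2 Y : ~ cont Y -> has_exists2.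
Proof.
  intros HY.
  destruct (classic (exists g, forall n, exists m, n <= m /\ Y @ (decode m (bar g m)) <> Y @ g))
    as [[g Hg] | Hseq].
  - destruct (@choice T0 (fun n m => n <= m /\ Y @ (decode m (bar g m)) <> Y @ g) choice_0)
      as [k Hk]; [unfold decode; decidability | exact Hg |].
    destruct (@definable_fun1 T0 T1 (fun n => decode (k @ n) (bar g (k @ n)))) as [s Hs];
      [unfold decode; definability |].
    apply (@grilliot Y g s); intros n; rewrite Hs; [apply bar_decode_bar |]; apply Hk.
  - apply not_all_ex_not in HY. destruct HY as [f Hf].
    destruct (@choice T0 (fun n p => bar (decode (first p) (second p)) n = bar f n /\
                Y @ (decode (first p) (second p)) <> Y @ f) choice_0) as [k Hk].
    + unfold decode. decidability.
    + intros n. apply NNPP. intros HN. apply Hf. exists n. intros g Hg.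
      apply NNPP. intros Hne. apply Hseq. exists g. intros j. apply NNPP. intros Hj.
      (* From length [j] on the continuations of [g] have the value [Y @ g]; length [n + j] also
         keeps the first [n] entries. *)
      apply HN. exists (pair_ (n + j) (bar g (n + j))). rewrite first_pair, second_pair.
      rewrite bar_decode_bar by apply le_addr. split; [auto |].
      intros E. apply Hj. exists (n + j). split; [apply le_addl | congruence].
    + destruct (@definable_fun1 T0 T1 (fun n => decode (first (k @ n)) (second (k @ n)))) as [s Hs];
        [unfold decode; definability |].
      apply (@grilliot Y f s); intros n; rewrite Hs; apply Hk.
Qed.

(** ** Quantification with [∃²] and with [κ] *)

Lemma decidable_ex : has_exists2 -> forall G (P : N -> env D G -> Prop),
  @decidable (T0 :: G) (fun r => P (fst r) (snd r)) -> decidable (fun r => exists n, P n r).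
Proof.
  intros [phi Hphi] G P [c [[x Hx] HP]].
  exists (fun r => phi @ (ap_env (t := T1) x r)). split.
  - apply definable_ap; [apply definable_const | exists x; reflexivity].
  - intros r. rewrite <- Hphi.
    assert (E : forall n, P n r <-> ap_env (t := T1) x r @ n = 0).
    { intros n. rewrite (HP (n, r) : P n r <-> _), <- Hx. reflexivity. }
    split; intros [n Hn]; exists n; apply E, Hn.
Qed.

Lemma decidable_all : has_exists2 -> forall G (P : N -> env D G -> Prop),
  @decidable (T0 :: G) (fun r => P (fst r) (snd r)) -> decidable (fun r => forall n, P n r).
Proof.
  intros HE2 G P HP.
  refine (decidable_iff _
    (decidable_not (decidable_ex HE2 (P := fun n r => ~ P n r) (decidable_not HP)))).
  intros r. cbn. split; [intros H [n Hn]; auto |].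
  intros H n. apply NNPP. eauto.
Qed.

(** The search operator applied to [F @ x] is itself a choice functional, whatever the type of
    [x]. *)
Lemma exists2_choice : has_exists2 -> forall s, choice_at s.
Proof.
  intros HE2 s F HF. destruct (exists2_mu HE2) as [m Hm].
  destruct (@definable_fun1 s T0 (fun x => m @ (F @ x))) as [Y HY]; [definability |].
  exists Y. intros x. rewrite HY. apply Hm, HF.
Qed.

Lemma decidable_exC : has_kappa -> forall G (P : D T1 -> env D G -> Prop),
  @decidable (T1 :: G) (fun r => P (fst r) (snd r)) ->
  decidable (fun r => exists h, inC h /\ P h r).
Proof.
  intros [kappa Hk] G P [c [[x Hx] HP]].
  destruct (@definable_fun2 T2 T1 T0 (fun Y h => neg (Y @ h))) as [W HW]; [definability |].
  exists (fun r => kappa @ (W @ (ap_env (t := T2) x r))). split.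
  - do 2 (apply definable_ap; [apply definable_const |]). exists x; reflexivity.
  - intros r. rewrite Hk.
    assert (E : forall h, P h r <-> 0 < W @ (ap_env (t := T2) x r) @ h).
    { intros h. rewrite (HP (h, r) : P h r <-> _), <- Hx, HW, pos_neq0, neg_eq0.
      cbn. split; [tauto | apply NNPP]. }
    split; intros (h & Hh & HPh); exists h; (split; [exact Hh | apply E, HPh]).
Qed.

(** ** [∃²] implies [FF] *)

(** The binary sequences that are eventually zero, numbered by pairs of a length and a code: a
    countable dense subset of Cantor space, over which ∃² can quantify. *)
Definition dense_point (a : N) : D T1 := point (first a) (second a).

Lemma dense_point_approx f n : inC f -> exists a, forall m, m <= n ->
  bar (dense_point a) m = bar f m.
Proof.
  intros Hf. exists (pair_ n (bar f n)). intros m Hm.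
  unfold dense_point. rewrite first_pair, second_pair. apply bar_point; assumption.
Qed.

Definition counterexample (Y : D T2) (f : D T1) (n m x y : N) : Prop :=
  bar (dense_point x) n = bar f n /\ bar (dense_point y) n = bar f n /\
  bar (dense_point x) m = bar (dense_point y) m /\
  Y @ (dense_point x) <> Y @ (dense_point y).

(** The neighbourhoods through which the path of the compactness argument runs. Restricting the
    failure of every modulus to dense points keeps the notion arithmetical. *)
Definition bad (Y : D T2) (f : D T1) (n : N) : Prop :=
  forall m, exists x, exists y, counterexample Y f n m x y.

(** If the two halves of the neighbourhood had moduli [m0] and [m1], then [n + 1 + (m0 + m1)] would
    serve for the whole: agreement up to [n + 1] puts both points into the same half, and the rest
    covers either modulus. *)
Lemma bad_split Y f n : inC f -> bad Y f n ->
  exists a, bar (dense_point a) n = bar f n /\ bad Y (dense_point a) (n + 1).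
Proof.
  intros Hf Hbad.
  assert (Hbit : forall i, i <= 1 -> exists a,
    bar (dense_point a) n = bar f n /\ dense_point a @ n = i).
  { intros i Hi.
    (* The first [n] entries of [f], continued with the constant [i]; a dense point approximating
       this to length [n + 1] lies in the half chosen by [i]. *)
    destruct (@definable_fun1 T0 T0 (fun j => cond (monus (j + 1) n) (f @ j) i)) as [h Hh];
      [definability |].
    destruct (@dense_point_approx h (n + 1)) as [a Ha].
    { intros j. rewrite Hh. destruct (classic (monus (j + 1) n = 0)) as [E | E].
      - rewrite cond_eq0 by exact E. apply Hf.
      - rewrite cond_neq0 by exact E. exact Hi. }
    exists a. split.
    - rewrite Ha by apply lt_le, lt_S. apply bar_eq. intros j Hj. rewrite Hh.
      apply cond_eq0, monus_eq0, lt_leS, Hj.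
    - pose proof (Ha _ (le_refl _)) as E. apply bar_S_eq in E. destruct E as [_ ->].
      rewrite Hh. apply cond_neq0. rewrite monus_eq0. apply lt_not_le, lt_S. }
  destruct (Hbit 0 (le0x 1)) as (a0 & E0 & B0). destruct (Hbit 1 (le_refl 1)) as (a1 & E1 & B1).
  apply NNPP. intros HN.
  assert (Hgood : forall a, bar (dense_point a) n = bar f n ->
    exists m, forall x y, ~ counterexample Y (dense_point a) (n + 1) m x y).
  { intros a Ea. apply NNPP. intros HN'. apply HN. exists a. split; [exact Ea |].
    intros m. apply NNPP. intros HN''. apply HN'. exists m. intros x y Hxy. apply HN''. exists x, y. exact Hxy. }
  destruct (Hgood a0 E0) as [m0 H0]. destruct (Hgood a1 E1) as [m1 H1].
  destruct (Hbad (n + 1 + (m0 + m1))) as (x & y & Ex & Ey & Exy & Hne).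
  assert (Em0 : bar (dense_point x) m0 = bar (dense_point y) m0).
  { apply (bar_eq_le (n := n + 1 + (m0 + m1))); [| exact Exy].
    apply le_tr with (m0 + m1); [apply le_addr | apply le_addl]. }
  assert (Em1 : bar (dense_point x) m1 = bar (dense_point y) m1).
  { apply (bar_eq_le (n := n + 1 + (m0 + m1))); [| exact Exy].
    apply le_tr with (m0 + m1); apply le_addl. }
  assert (En : bar (dense_point x) (n + 1) = bar (dense_point y) (n + 1))
    by exact (bar_eq_le (le_addr _ _) Exy).
  assert (HB : dense_point x @ n <= 1) by apply point_inC.
  apply le1_cases in HB. destruct HB as [B | B].
  - apply (H0 x y). repeat split; auto; rewrite <- ?En; apply bar_S_eq; split; congruence.
  - apply (H1 x y). repeat split; auto; rewrite <- ?En; apply bar_S_eq; split; congruence.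
Qed.

Lemma decidable_bad (HE2 : has_exists2) G (Y : env D G -> D T2) (f : env D G -> D T1)
  (n : env D G -> N) :
  definable Y -> definable f -> definable n -> decidable (fun r => bad (Y r) (f r) (n r)).
Proof.
  intros HY Hf Hn. unfold bad.
  apply (@decidable_all HE2 G (fun m r => exists x, exists y,
    counterexample (Y r) (f r) (n r) m x y)).
  apply (@decidable_ex HE2 (T0 :: G) (fun x r => exists y,
    counterexample (Y (snd r)) (f (snd r)) (n (snd r)) (fst r) x y)).
  apply (@decidable_ex HE2 (T0 :: T0 :: G) (fun y r =>
    counterexample (Y (snd (snd r))) (f (snd (snd r))) (n (snd (snd r))) (fst (snd r)) (fst r) y)).
  pose proof (definable_snd T0 (definable_snd T0 (definable_snd T0 HY))).
  pose proof (definable_snd T0 (definable_snd T0 (definable_snd T0 Hf))).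
  pose proof (definable_snd T0 (definable_snd T0 (definable_snd T0 Hn))).
  unfold counterexample, dense_point. cbn [fst snd]. decidability.
Qed.

(** Repeated halving yields dense points [A @ n], each agreeing with the next up to length [n].
    Every neighbourhood of their limit [g] is bad, whereas by continuity [Y] is constant on one of
    them. *)
Lemma cont_not_bad (HE2 : has_exists2) Y f : cont Y -> inC f -> ~ bad Y f 0.
Proof.
  intros HY Hf Hbad.
  (* [p] pairs a length with the number of a dense point. The implication makes the relation total:
     0 serves where the neighbourhood is not bad. *)
  destruct (@choice T0 (fun p b => bad Y (dense_point (second p)) (first p) ->
      bar (dense_point b) (first p) = bar (dense_point (second p)) (first p) /\
      bad Y (dense_point b) (first p + 1)) choice_0) as [s Hs].
  - unfold dense_point. apply decidable_imp; [| apply decidable_and; [decidability |]];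
      apply decidable_bad; auto; definability.
  - intros p. destruct (classic (bad Y (dense_point (second p)) (first p))) as [H | H].
    + destruct (bad_split (point_inC _ _) H) as [b Hb]. exists b. auto.
    + exists 0. contradiction.
  - destruct (@definable_fun2 T0 T0 T0 (fun n a => s @ (pair_ n a))) as [h Hh]; [definability |].
    destruct (@definable_fun1 T0 T0 (primrec h 0)) as [A HA]; [definability |].
    assert (HAS : forall n, bad Y (dense_point (A @ n)) n ->
      bar (dense_point (A @ (n + 1))) n = bar (dense_point (A @ n)) n /\
      bad Y (dense_point (A @ (n + 1))) (n + 1)).
    { intros n Hn. rewrite HA, primrec_S, Hh, <- HA.
      pose proof (Hs (pair_ n (A @ n))) as H. rewrite first_pair, second_pair in H. auto. }
    assert (HAbad : forall n, bad Y (dense_point (A @ n)) n).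
    { refine (ind _ _ _).
      - unfold dense_point. apply decidable_bad; auto; definability.
      (* At length 0 the neighbourhood is the whole space, so badness does not depend on its
         centre. *)
      - intros m. destruct (Hbad m) as (x & y & Hxy). exists x, y.
        unfold counterexample in *. rewrite !bar_0 in *. exact Hxy.
      - intros n Hn. apply HAS, Hn. }
    destruct (@definable_fun1 T0 T0 (fun i => dense_point (A @ (i + 1)) @ i)) as [g Hg];
      [unfold dense_point; definability |].
    assert (Hgn : forall n, bar g n = bar (dense_point (A @ n)) n).
    { refine (ind _ _ _); [unfold dense_point; decidability | rewrite !bar_0; reflexivity |].
      intros n IH. apply bar_S_eq. split; [| apply Hg].
      rewrite IH. symmetry. apply HAS, HAbad. }
    destruct (HY g) as [n Hn]. destruct (HAbad n 0) as (x & y & Ex & Ey & _ & Hne).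
    apply Hne. transitivity (Y @ g); [symmetry |]; apply Hn; rewrite Hgn; congruence.
Qed.

Lemma exists2_FF : has_exists2 -> has_FF.
Proof.
  intros HE2.
  (* The arithmetical form of being a modulus, tested on dense points only. *)
  set (mod' := fun (Y : D T2) (m : N) => forall x, forall y,
    bar (dense_point x) m = bar (dense_point y) m -> Y @ (dense_point x) = Y @ (dense_point y)).
  assert (Hmod : forall G (Y : env D G -> D T2) (m : env D G -> N),
    definable Y -> definable m -> decidable (fun r => mod' (Y r) (m r))).
  { intros G Y m HY Hm. unfold mod'.
    apply (@decidable_all HE2 G (fun x r => forall y,
      bar (dense_point x) (m r) = bar (dense_point y) (m r) ->
      Y r @ (dense_point x) = Y r @ (dense_point y))).
    apply (@decidable_all HE2 (T0 :: G) (fun y r =>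
      bar (dense_point (fst r)) (m (snd r)) = bar (dense_point y) (m (snd r)) ->
      Y (snd r) @ (dense_point (fst r)) = Y (snd r) @ (dense_point y))).
    pose proof (definable_snd T0 (definable_snd T0 HY)).
    pose proof (definable_snd T0 (definable_snd T0 Hm)).
    unfold dense_point. cbn [fst snd]. decidability. }
  destruct (@choice T2 (fun Y m => (exists k, mod' Y k) -> mod' Y m) (exists2_choice HE2 (s := T2)))
    as [Phi HPhi].
  - apply decidable_imp; [| apply Hmod; definability].
    apply (@decidable_ex HE2 [T0; T2] (fun k r => mod' (fst (snd r)) k)).
    apply Hmod; definability.
  - intros Y. destruct (classic (exists k, mod' Y k)) as [[k Hk] | HN]; [eauto |].
    exists 0. contradiction.
  - exists Phi. intros Y HY.
    assert (HM : mod' Y (Phi @ Y)).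
    { apply HPhi. apply NNPP. intros HN.
      apply (cont_not_bad HE2 (f := point 0 0) HY (point_inC _ _)). intros m.
      apply NNPP. intros HN'. apply HN. exists m. intros x y Hxy. apply NNPP. intros Hne.
      apply HN'. exists x, y. repeat split; auto; rewrite !bar_0; reflexivity. }
    intros f g Hf Hg Hfg. destruct (HY f) as [n1 H1]. destruct (HY g) as [n2 H2].
    (* The approximations are long enough for the modulus and for the continuity of [Y] at both [f]
       and [g]. *)
    destruct (dense_point_approx (Phi @ Y + (n1 + n2)) Hf) as [x Hx].
    destruct (dense_point_approx (Phi @ Y + (n1 + n2)) Hg) as [y Hy].
    assert (Ln1 : n1 <= Phi @ Y + (n1 + n2)) by (eapply le_tr; [apply le_addr | apply le_addl]).
    assert (Ln2 : n2 <= Phi @ Y + (n1 + n2)) by (eapply le_tr; apply le_addl).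
    rewrite (H1 (dense_point x)) by (symmetry; apply Hx; assumption).
    rewrite (H2 (dense_point y)) by (symmetry; apply Hy; assumption).
    apply HM. rewrite Hx, Hy by apply le_addr. exact Hfg.
Qed.

Lemma FF_exists2_or_MUC : has_FF -> has_exists2 \/ has_MUC.
Proof.
  intros [Phi HPhi]. destruct (classic has_exists2) as [H | H]; [left; exact H | right].
  exists Phi. intros Y. apply HPhi. apply NNPP. intros HN. exact (H (discontinuous_exists2 HN)).
Qed.

(** ** [MUC] from [κ] *)

(** Going up [n] steps from a code of length [n] reaches 0, while from a code of length [n + d] it
    leaves a code of length [d], which is at least [d]. *)
Lemma bar_length f g n m : bar f n = bar g m -> n = m.
Proof.
  assert (W : forall f g n m, bar f n = bar g m -> m <= n).
  { clear. intros f g n m E. apply not_lt. intros H.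
    destruct (lt_ex_diff H) as [d <-].
    assert (H0 : ancestor (bar f n) n = 0).
    { rewrite ancestor_bar by apply le_refl. rewrite <- (addx0 n) at 1.
      rewrite monus_addl. apply bar_0. }
    rewrite E, ancestor_bar, monus_addl in H0 by apply le_addr.
    pose proof (le_bar g d) as Hd. rewrite H0 in Hd. apply le0 in Hd. subst d.
    rewrite addx0 in H. exact (lt_irr H). }
  intros E. apply le_antisym; eapply W; [symmetry |]; exact E.
Qed.

Lemma ex_part : exists F : D (T0 ⟶ T1 ⟶ T1), forall k h i, F @ k @ h @ i = h @ (pair_ k i).
Proof. apply definable_fun3; definability. Qed.

(** κ quantifies over a single element of Cantor space; [part 0] and [part 1] read two such elements
    from one, so that it covers pairs as well. *)
Definition part (k : N) (h : D T1) : D T1 := (pick ex_part) @ k @ h.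

Lemma part_inC k h : inC h -> inC (part k h).
Proof. intros H i. unfold part. rewrite (pickP ex_part). apply H. Qed.

Lemma join f g : inC f -> inC g -> exists h, inC h /\ part 0 h = f /\ part 1 h = g.
Proof.
  intros Hf Hg.
  destruct (@definable_fun1 T0 T0 (fun p => cond (first p) (f @ (second p)) (g @ (second p))))
    as [h Hh]; [definability |].
  exists h. repeat split.
  - intros p. rewrite Hh. destruct (classic (first p = 0)) as [E | E].
    + rewrite cond_eq0 by exact E. apply Hf.
    + rewrite cond_neq0 by exact E. apply Hg.
  - apply M_ext. intros i. unfold part. rewrite (pickP ex_part), Hh, first_pair, second_pair.
    apply cond_eq0. reflexivity.
  - apply M_ext. intros i. unfold part. rewrite (pickP ex_part), Hh, first_pair, second_pair.
    apply cond_neq0, neq10.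
Qed.

Lemma decidable_modulus : has_kappa ->
  @decidable [T0; T2] (fun r => modulus (fst (snd r)) (fst r)).
Proof.
  intros Hk.
  apply decidable_iff with (fun r : env D [T0; T2] => ~ exists h, inC h /\
    (bar (part 0 h) (fst r) = bar (part 1 h) (fst r) /\
     (fst (snd r)) @ (part 0 h) <> (fst (snd r)) @ (part 1 h))).
  - intros (m & Y & []). cbn [fst snd]. split.
    + intros HY (h & Hh & E & Hne). apply Hne, HY; auto using part_inC.
    + intros HN f g Hf Hg E. apply NNPP. intros Hne. apply HN.
      destruct (join Hf Hg) as (h & Hh & E0 & E1). exists h. rewrite E0, E1. auto.
  - apply decidable_not. apply (@decidable_exC Hk [T0; T2] (fun h r =>
      bar (part 0 h) (fst r) = bar (part 1 h) (fst r) /\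
      (fst (snd r)) @ (part 0 h) <> (fst (snd r)) @ (part 1 h))).
    unfold part. decidability.
Qed.

(** The nodes of the tree are those on whose neighbourhood [Y] is not constant. *)
Lemma kappa_WKL_modulus : has_kappa -> has_WKL -> forall Y, cont Y -> exists m, modulus Y m.
Proof.
  intros Hk HW Y HY.
  (* The length [n] of a sequence never exceeds its code [v], which bounds the search for it. *)
  destruct (@decidable_char T0 (fun v => exists n, n < v + 1 /\ exists h, inC h /\
      (bar (part 0 h) n = v /\ bar (part 1 h) n = v /\
       Y @ (part 0 h) <> Y @ (part 1 h)))) as [T HT].
  { apply (@decidable_bex [T0] (fun r => fst r + 1) (fun n r => exists h, inC h /\
      (bar (part 0 h) n = fst r /\ bar (part 1 h) n = fst r /\
       Y @ (part 0 h) <> Y @ (part 1 h)))); [definability |].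
    apply (@decidable_exC Hk [T0; T0] (fun h r =>
       bar (part 0 h) (fst r) = fst (snd r) /\ bar (part 1 h) (fst r) = fst (snd r) /\
       Y @ (part 0 h) <> Y @ (part 1 h))).
    unfold part. decidability. }
  assert (Hin : forall f g n, inC f -> inC g -> bar f n = bar g n -> Y @ f <> Y @ g ->
    T @ (bar f n) = 1).
  { intros f g n Hf Hg Hfg Hne. apply HT. exists n. split; [apply lt_S_le, le_bar |].
    destruct (join Hf Hg) as (h & Hh & E0 & E1). exists h. rewrite E0, E1. auto. }
  assert (Hout : forall v, T @ v = 1 -> exists f g n, inC f /\ inC g /\
    bar f n = v /\ bar g n = v /\ Y @ f <> Y @ g).
  { intros v Hv. apply HT in Hv. destruct Hv as (n & _ & h & Hh & E0 & E1 & Hne).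
    exists (part 0 h), (part 1 h), n. auto 7 using part_inC. }
  destruct (classic (forall n, exists v, n < v /\ T @ v = 1)) as [Hinf | Hfin].
  - exfalso. destruct (HW T) as (f & _ & Hf); [| exact Hinf |].
    + split; [intros v; apply HT |]. intros v Hv.
      destruct (Hout v Hv) as (f & g & n & Hf & Hg & <- & Efg & Hne).
      destruct (pos_or_0 n) as [-> | Hn]; [left; apply bar_0 | right].
      apply lt_leS in Hn. destruct (le_ex_diff Hn) as [d <-].
      replace (0 + 1 + d) with (d + 1) in * by ring.
      exists (bar f d), (f @ d). rewrite bar_S. repeat split; [apply Hf |].
      apply (Hin f g d Hf Hg); [| exact Hne].
      apply bar_S_eq in Efg. symmetry. apply Efg.
    (* By continuity [Y] is constant on some neighbourhood of the path, although that neighbourhood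
       is a node of the tree. *)
    + destruct (HY f) as [n Hn].
      destruct (Hout _ (Hf n)) as (g & g' & k & _ & _ & E & E' & Hne).
      pose proof (bar_length E) as ->. apply Hne.
      rewrite <- (Hn g), <- (Hn g') by congruence. reflexivity.
  (* With no node beyond [n], length [n + 1] is a modulus, because a code of that length is at least
     [n + 1]. *)
  - apply not_all_ex_not in Hfin. destruct Hfin as [n Hn].
    exists (n + 1). intros f g Hf Hg Hfg. apply NNPP. intros Hne. apply Hn.
    exists (bar f (n + 1)). split; [| exact (Hin f g _ Hf Hg Hfg Hne)].
    apply lt_le_tr with (2 := le_bar f _), lt_S.
Qed.

(** This is where choice at type 2 enters: it collects the moduli of the individual functionals into
    one [Omega], κ having made the property decidable. *)
Lemma kappa_WKL : choice_at T2 -> has_kappa -> has_WKL -> has_exists3 \/ has_MUC.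
Proof.
  intros HAC Hk HW. destruct (classic has_exists2) as [HE | HE].
  - left. apply kappa_exists3; assumption.
  - right.
    destruct (@choice T2 (fun Y m => modulus Y m) HAC) as [Omega HO].
    + apply decidable_modulus, Hk.
    + intros Y. apply kappa_WKL_modulus; auto.
      apply NNPP. intros HN. exact (HE (discontinuous_exists2 HN)).
    + exists Omega. exact HO.
Qed.

(** ** Meaning of the formulas *)

Lemma sat_IsBar G (f h : term G T1) (rho : env D G) :
  sat (IsBar f h) rho <-> forall n, (eval h rho) @ n = bar (eval f rho) n.
Proof.
  unfold IsBar. cbn [sat eval]. split.
  - intros [H0 HS]. refine (ind _ _ _); [decidability | |].
    + rewrite bar_0. exact H0.
    + intros n IH. specialize (HS n). cbn in HS. rewrite !eval_tlift in HS.
      rewrite bar_S, <- IH. exact HS.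
  - intros H. split; [rewrite H; apply bar_0 |]. intros n. cbn. rewrite !eval_tlift.
    transitivity (bar (eval f rho) (n + 1)); [apply H |]. rewrite bar_S, <- H. reflexivity.
Qed.

Lemma sat_BarEq G (f g : term G T1) (n : term G T0) (rho : env D G) :
  sat (BarEq f g n) rho
  <-> bar (eval f rho) (eval n rho) = bar (eval g rho) (eval n rho).
Proof.
  unfold BarEq. cbn [sat]. split.
  - intros (h & k & Hh & Hk & E). rewrite sat_IsBar in Hh, Hk. cbn [eval lookup fst snd] in *.
    rewrite !eval_tlift in *. rewrite <- Hh, <- Hk. exact E.
  - intros E.
    destruct (@definable_fun1 T0 T0 (bar (eval f rho))) as [h Hh]; [definability |].
    destruct (@definable_fun1 T0 T0 (bar (eval g rho))) as [k Hk]; [definability |].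
    exists h, k. rewrite !sat_IsBar. cbn [eval lookup fst snd].
    rewrite !eval_tlift. repeat split; auto. rewrite Hh, Hk. exact E.
Qed.

Lemma sat_InC G (f : term G T1) (rho : env D G) : sat (InC f) rho <-> inC (eval f rho).
Proof.
  unfold InC, inC. cbn [LeT T1 sat OneT Le0 eval].
  split; intros H i; specialize (H i); cbn in *; rewrite ?eval_tlift, ?ap_K in *; exact H.
Qed.

Lemma sat_ModulusOnC G (Y : term G T2) m (rho : env D G) :
  sat (ModulusOnC Y m) rho <-> modulus (eval Y rho) (eval m rho).
Proof.
  unfold ModulusOnC, modulus. cbn [sat].
  split; intros H f g; specialize (H f g);
    rewrite !sat_InC, sat_BarEq in *; cbn [eval lookup fst snd] in *;
    rewrite !eval_tlift in *; tauto.
Qed.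

Lemma sat_Cont G (Y : term G T2) (rho : env D G) : sat (Cont Y) rho <-> cont (eval Y rho).
Proof.
  unfold Cont, cont. cbn [sat].
  split; intros H f; destruct (H f) as [n Hn]; exists n; intros g; specialize (Hn g);
    rewrite sat_BarEq in *; cbn [eval lookup fst snd] in *; rewrite !eval_tlift in *; exact Hn.
Qed.

Lemma sat_Kappa0 : @sat M [] Kappa0 tt <-> has_kappa.
Proof.
  unfold Kappa0, has_kappa. cbn [sat].
  assert (E : forall kappa Y, (exists f : D T1,
      @sat M [T1; T2; T3] (InC v0) (f, (Y, (kappa, tt))) /\ 0 < Y @ f)
    <-> exists f, inC f /\ 0 < Y @ f).
  { intros kappa Y. split; intros (f & Hf & Hp); exists f;
      (split; [apply sat_InC in Hf || apply sat_InC; exact Hf | exact Hp]). }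
  split; intros [kappa H]; exists kappa; intros Y; specialize (H Y);
    specialize (E kappa Y); cbn [eval lookup fst snd] in *; tauto.
Qed.

Lemma sat_MUC : @sat M [] MUC tt <-> has_MUC.
Proof.
  unfold MUC, has_MUC. cbn [sat].
  split; intros [O H]; exists O; intros Y; specialize (H Y); apply sat_ModulusOnC in H || apply sat_ModulusOnC; exact H.
Qed.

Lemma sat_FF : @sat M [] FF tt <-> has_FF.
Proof.
  unfold FF, has_FF. cbn [sat].
  split; intros [O H]; exists O; intros Y; specialize (H Y);
    rewrite sat_Cont, sat_ModulusOnC in *; exact H.
Qed.

Lemma sat_Exists2 : @sat M [] Exists2 tt <-> has_exists2.
Proof.
  unfold Exists2, has_exists2. cbn. split.
  - intros (phi & _ & H). exists phi. intros f. specialize (H f). tauto.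
  - intros [phi H].
    (* [sg] keeps the zeros and supplies the bound by 1 that the formula demands. *)
    destruct (@definable_fun1 T1 T0 (fun f => sg (phi @ f))) as [psi Hpsi]; [definability |].
    exists psi. split; intros f; rewrite Hpsi.
    + rewrite ap_K. apply sg_le1.
    + specialize (H f). rewrite sg_eq0. tauto.
Qed.

Lemma sat_Exists3 : @sat M [] Exists3 tt <-> has_exists3.
Proof.
  unfold Exists3, has_exists3. cbn. split.
  - intros (E & _ & H). exists E. intros Y. specialize (H Y). tauto.
  - intros [E H].
    destruct (@definable_fun1 T2 T0 (fun Y => sg (E @ Y))) as [F HF]; [definability |].
    exists F. split; intros Y; rewrite HF.
    + rewrite ap_K. apply sg_le1.
    + specialize (H Y). rewrite sg_eq0. tauto.
Qed.

Lemma sat_BinaryTree G (T : term G T1) (rho : env D G) :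
  sat (BinaryTree T) rho <-> binary_tree (eval T rho).
Proof.
  unfold BinaryTree, binary_tree. cbn [sat].
  pose proof (sat_InC T rho) as HC. unfold InC, inC in HC. rewrite HC.
  split; intros [H1 H2]; (split; [exact H1 |]); intros n Hn; specialize (H2 n);
    cbn in *; rewrite !eval_tlift in *;
    (destruct (H2 Hn) as [H | (s & a & Ha & E & Hs)]; [left; exact H | right; exists s, a]);
    rewrite ?eval_tlift in *; auto.
Qed.

Lemma sat_Path G (f T : term G T1) (rho : env D G) :
  sat (Path f T) rho <-> inC (eval f rho) /\ forall n, (eval T rho) @ (bar (eval f rho) n) = 1.
Proof.
  unfold Path. cbn [sat]. rewrite sat_InC. split.
  - intros (Hf & h & Hh & H). split; [exact Hf |]. intros n. specialize (H n).
    rewrite sat_IsBar in Hh. cbn in *. rewrite !eval_tlift in *. rewrite <- Hh. exact H.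
  - intros [Hf H]. split; [exact Hf |].
    destruct (@definable_fun1 T0 T0 (bar (eval f rho))) as [h Hh]; [definability |].
    exists h. rewrite sat_IsBar. cbn. rewrite eval_tlift. split; [exact Hh |].
    intros n. rewrite !eval_tlift, Hh. apply H.
Qed.

Lemma sat_WKL G (rho : env D G) : @sat M G WKL rho <-> has_WKL.
Proof.
  unfold WKL, has_WKL. cbn [sat].
  split; intros H T.
  - intros HT Hinf. destruct (H T) as [f Hf].
    + rewrite sat_BinaryTree. split; [exact HT | exact Hinf].
    + apply sat_Path in Hf. exists f. exact Hf.
  - rewrite sat_BinaryTree. intros [HT Hinf]. destruct (H T HT Hinf) as [f Hf].
    exists f. apply sat_Path. exact Hf.
Qed.

(** * The equivalences in a model and their transfer to derivability *)

Lemma kappa_WKL_iff : choice_at T2 -> (has_kappa /\ has_WKL <-> has_exists3 \/ has_MUC).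
Proof.
  intros HAC. split; [intros [Hk HW]; exact (kappa_WKL HAC Hk HW) |].
  intros [H | H].
  - auto using exists3_kappa, exists3_exists2, exists2_FF, FF_WKL.
  - auto using MUC_kappa, MUC_FF, FF_WKL.
Qed.

Lemma kappa_FF_iff : choice_at T2 -> (has_exists3 \/ has_MUC <-> has_kappa /\ has_FF).
Proof.
  intros HAC. split; [| intros [Hk HF]; apply kappa_WKL; auto using FF_WKL].
  intros [H | H].
  - auto using exists3_kappa, exists3_exists2, exists2_FF.
  - auto using MUC_kappa, MUC_FF.
Qed.

Lemma FF_iff : has_FF <-> has_exists2 \/ has_MUC.
Proof.
  split; [exact FF_exists2_or_MUC |].
  intros [H | H]; auto using exists2_FF, MUC_FF.
Qed.

Lemma FF_kappa_iff : choice_at T2 -> has_WKL -> (has_FF <-> has_exists2 \/ has_kappa).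
Proof.
  intros HAC HW. rewrite FF_iff. split; intros [H | H]; auto using MUC_kappa.
  destruct (kappa_WKL HAC H HW); auto using exists3_exists2.
Qed.

End Model.

Lemma completeness_RCA0w (T : theory) (A : formula []) : subst_closed T ->
  (forall G (B : formula G), RCA0w B -> T G B) ->
  (forall M : model, extensional M ->
     (forall G (B : formula G), T G B -> forall rho, @sat M G B rho) -> @sat M [] A tt) ->
  T ⊢ A.
Proof.
  intros HT HR HM. apply completeness; [exact HT | | exact HM].
  intros G s t x y f. apply HR. left. apply ax_ext.
Qed.

Theorem theorem3p6 :
  (RCA0w ⊕ QF_AC T2 T0 ⊢
     ((Kappa0 ⩓ WKL) ⇔ (Exists3 ⩔ MUC)) ⩓
     ((Exists3 ⩔ MUC) ⇔ (Kappa0 ⩓ FF))) /\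
  (RCA0w ⊢ FF ⇔ (Exists2 ⩔ MUC)) /\
  (WKL0w ⊕ QF_AC T2 T0 ⊢ FF ⇔ (Exists2 ⩔ Kappa0)).
Proof.
  split; [| split]; apply completeness_RCA0w.
  - apply tunion_closed; [apply RCA0w_closed | apply QF_AC_closed].
  - intros G B HB. left. exact HB.
  - intros M Mext HM.
    assert (HR : forall G (A : formula G), RCA0w A -> forall rho, @sat M G A rho)
      by (intros G A HA; apply HM; left; exact HA).
    assert (HAC : choice_at M T2)
      by (apply choice_of_sat; intros G A HA; apply HM; right; exact HA).
    pose proof (kappa_WKL_iff Mext HR HAC). pose proof (kappa_FF_iff Mext HR HAC).
    cbn [sat]. rewrite sat_Kappa0, (sat_WKL Mext HR), sat_Exists3, (sat_MUC Mext HR), (sat_FF Mext HR)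
      by assumption. tauto.
  - exact RCA0w_closed.
  - auto.
  - intros M Mext HR. pose proof (FF_iff Mext HR).
    cbn [sat]. rewrite sat_Exists2, (sat_MUC Mext HR), (sat_FF Mext HR) by assumption. tauto.
  - repeat apply tunion_closed;
      auto using RCA0w_closed, QF_AC_closed, WKL_ax_closed, RCA_basic_closed.
  - intros G B HB. left. left. exact HB.
  - intros M Mext HM.
    assert (HR : forall G (A : formula G), RCA0w A -> forall rho, @sat M G A rho)
      by (intros G A HA; apply HM; left; left; exact HA).
    assert (HAC : choice_at M T2)
      by (apply choice_of_sat; intros G A HA; apply HM; right; exact HA).
    assert (HW : has_WKL Mext HR).
    { apply (sat_WKL (G := []) Mext HR tt), HM. left. right. constructor. }
    pose proof (FF_kappa_iff HAC HW).
    cbn [sat]. rewrite sat_Exists2, sat_Kappa0, (sat_FF Mext HR) by assumption. tauto.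
Qed.
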